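(* Let $\alpha,\beta$ be fixed real numbers with $\alpha>0$, $\beta>\frac12$, $\alpha+\beta<1$, and such that for every integer $j\ge 0$, \[ \bigl(1+(1-\alpha)\alpha^{j}\bigr)\bigl(1-(1-\beta)^{j+1}\bigr)<1 . \] Then there exists $n_0=n_0(\alpha,\beta)$ such that for all $n>n_0$, with $k=\lfloor\alpha n\rfloor$ and $l=\lfloor\beta n\rfloor$, we have $M(n,k,l)=\binom{n-1}{k-1}\binom{n-1}{l-1}$. Moreover, if $\mathcal{A}\subset\binom{[n]}{k}$ and $\mathcal{B}\subset\binom{[n]}{l}$ are cross-intersecting families with $|\mathcal{A}||\mathcal{B}|=\binom{n-1}{k-1}\binom{n-1}{l-1}$, then there is $i\in[n]$ such that $\mathcal{A}=\{A\in\binom{[n]}{k}:i\in A\}$ and $\mathcal{B}=\{B\in\binom{[n]}{l}:i\in B\}$.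
   Context: $[n]=\{1,\dots,n\}$ and $\binom{[n]}{k}$ is the set of $k$-element subsets of $[n]$. Families $\mathcal{A},\mathcal{B}$ are cross-intersecting if $A\cap B\ne\emptyset$ for all $A\in\mathcal{A},B\in\mathcal{B}$. $M(n,k,l)$ denotes the maximum of $|\mathcal{A}||\mathcal{B}|$ over cross-intersecting families $\mathcal{A}\subset\binom{[n]}{k}$, $\mathcal{B}\subset\binom{[n]}{l}$. The displayed condition is equivalent to $\mu_\alpha(\mathcal{A}_j)\mu_\beta(\mathcal{B}_j)<\alpha\beta$ where $\mu_\alpha(\mathcal{A}_j)=\alpha+(1-\alpha)\alpha^{j+1}$ and $\mu_\beta(\mathcal{B}_j)=\beta-\beta(1-\beta)^{j+1}$. *)

(* Defs.v *)
From mathcomp Require Import all_boot all_order all_algebra.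
From mathcomp Require Import reals.

Set Implicit Arguments.
Unset Strict Implicit.
Unset Printing Implicit Defensive.

(* The ground set [n] = {1, ..., n} is represented by 'I_n. *)

Definition layer (n k : nat) : {set {set 'I_n}} :=
  [set A : {set 'I_n} | #|A| == k].

Definition cross_intersecting (n : nat) (A B : {set {set 'I_n}}) : bool :=
  [forall X in A, forall Y in B, X :&: Y != set0].

(* The maximum is over a nonempty range: the pair (set0, set0) qualifies. *)
Definition max_cross (n k l : nat) : nat :=
  \max_(P : {set {set 'I_n}} * {set {set 'I_n}} |
         [&& P.1 \subset layer n k, P.2 \subset layer n l
           & cross_intersecting P.1 P.2]) (#|P.1| * #|P.2|)%N.

(* Main.v *)
Require Import Defs.
From mathcomp Require Import all_boot all_order all_algebra.
From mathcomp Require Import reals.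
From mathcomp Require Import perm zify ring lra.

(** Write k, l for the two set sizes.  If neither |A| nor |B| exceeds the size of a star there is
nothing to prove, so let |A| = 'C(n-1, k-1) + f with f > 0 (the other case is the same with alpha
and beta exchanged).  By Kruskal-Katona in cascade form, applied to the complements of the
members of A, many sets lie below these complements and are therefore unavailable to B.

If f is below a small fraction of 'C(n-1, k), one binomial coefficient of the cascade suffices:
since alpha < 1 - beta, the relative loss of B exceeds the relative gain of A by an exponentially
large factor.  Otherwise the first D digits of the cascade form a binary word, and as n grows the
pair of relative sizes tends to a point (x, u) of the self-similar region [lex_region]; what
matters is that (1 + (1 - alpha) / alpha * x) * (1 - u) stays away from 1 there.  At the points
(alpha ^ (j + 1), (1 - beta) ^ (j + 1)) this is the hypothesis.  Between two such points the
quantity is bilinear.  Once the criterion of [lex_region_bilinear] holds, it is controlled by its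
values at the two ends, because the criterion is inherited by both halves; where the criterion
fails, u >= x or one subdivision is enough.  For the exchanged pair u >= x already gives the bound.

Equality forces both families to have the size of a star, and then the uniqueness of the extremal
families for the shadow, proved by undoing shifts, makes them stars. *)

Set Implicit Arguments.
Unset Strict Implicit.
Unset Printing Implicit Defensive.

(** * Shifting and shadows *)

Section Families.
Variable T : finType.
Implicit Types (X Y Z S : {set T}) (F : {set {set T}}) (i j x : T).

Definition uniform_on S r F := forall X, X \in F -> X \subset S /\ #|X| = r.

Definition shadow F : {set {set T}} :=
  [set Y : {set T} | [exists x : T, (x \notin Y) && (x |: Y \in F)]].

Lemma shadowP F Y :
  reflect (exists2 x, x \notin Y & x |: Y \in F) (Y \in shadow F).
Proof.
rewrite inE; apply: (iffP existsP) => [[x /andP[xY xF]]|[x xY xF]]; exists x => //.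
by rewrite xY.
Qed.

Lemma uniform_shadow S r F : uniform_on S r.+1 F -> uniform_on S r (shadow F).
Proof.
move=> FU Y /shadowP[x xY /FU[sub]]; rewrite cardsU1 xY add1n => -[->]; split=> //.
exact: subset_trans (subsetUr _ _) sub.
Qed.

Definition swap i j X : {set T} := tperm i j @: X.

Lemma in_swap i j X x : (x \in swap i j X) = (tperm i j x \in X).
Proof. by rewrite -{1}[x](tpermK i j) mem_imset //; apply: perm_inj. Qed.

Lemma swapK i j : involutive (swap i j).
Proof. by move=> X; apply/setP=> x; rewrite !in_swap tpermK. Qed.

Lemma card_swap i j X : #|swap i j X| = #|X|.
Proof. by rewrite card_imset //; apply: perm_inj. Qed.

Lemma swap_subset S i j X :
  i \in S -> j \in S -> (swap i j X \subset S) = (X \subset S).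
Proof.
move=> iS jS; have sw Y : Y \subset S -> swap i j Y \subset S.
  move=> /subsetP YS; apply/subsetP=> x; rewrite in_swap => /YS.
  by case: tpermP => // ->.
by apply/idP/idP => [/sw|/sw //]; rewrite swapK.
Qed.

Lemma swap_id i j X : (i \in X) = (j \in X) -> swap i j X = X.
Proof.
by move=> eq; apply/setP=> x; rewrite in_swap; case: tpermP => // ->; rewrite eq.
Qed.

Lemma swapU1 i j X : j \in X -> i \notin X -> swap i j X = i |: X :\ j.
Proof.
move=> jX iX; have neq : i != j by apply: contraNneq iX => ->.
apply/setP=> x; rewrite in_swap !inE; case: tpermP => [->|->|/eqP nx /eqP ny].
- by rewrite eqxx jX.
- by rewrite eqxx (negPf iX) eq_sym (negPf neq).
- by rewrite (negPf nx) ny.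
Qed.

Definition shift i j F : {set {set T}} :=
  [set X : {set T} | if i \in X then (X \in F) || (swap i j X \in F)
           else (X \in F) && (swap i j X \in F)].

Lemma in_shift i j F X : (X \in shift i j F) =
  if i \in X then (X \in F) || (swap i j X \in F)
  else (X \in F) && (swap i j X \in F).
Proof. by rewrite inE. Qed.

(* For each X, as many of X and swap i j X belong to shift i j F as to F. *)
Lemma card_shift i j F : #|shift i j F| = #|F|.
Proof.
have double F' : \sum_X ((X \in F') + (swap i j X \in F'))%N = #|F'|.*2.
  have sum1 : \sum_X (X \in F' : nat) = #|F'|.
    by rewrite -sum1_card [RHS]big_mkcond /=; apply: eq_bigr => X _; case: (X \in F').
  rewrite big_split /= -addnn {1}sum1; congr (_ + _)%N.
  by rewrite -[RHS]sum1 [RHS](reindex_inj (inv_inj (swapK i j))).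
apply: double_inj; rewrite -!double; apply: eq_bigr => X _.
rewrite !in_shift swapK in_swap tpermL.
have [eq|] := eqVneq (i \in X) (j \in X).
  by rewrite swap_id // -eq orbb andbb if_same.
by case: (i \in X); case: (j \in X) => // _;
  case: (X \in F); case: (swap i j X \in F).
Qed.

Lemma uniform_shift S r i j F :
  i \in S -> j \in S -> uniform_on S r F -> uniform_on S r (shift i j F).
Proof.
move=> iS jS FU X; rewrite in_shift => XF.
have /orP[/FU //|/FU[]] : (X \in F) || (swap i j X \in F).
  by case: ifP XF => // _ /andP[->].
by rewrite swap_subset // card_swap.
Qed.

Lemma swap_setU1 i j x X :
  swap i j (x |: X) = tperm i j x |: swap i j X.
Proof. by rewrite /swap imsetU1. Qed.

Lemma shadow_swap i j F Y x :
  x \notin Y -> swap i j (x |: Y) \in F -> swap i j Y \in shadow F.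
Proof.
move=> xY; rewrite swap_setU1 => H; apply/shadowP.
by exists (tperm i j x) => //; rewrite in_swap tpermK.
Qed.

Lemma shadow_shift i j F : shadow (shift i j F) \subset shift i j (shadow F).
Proof.
apply/subsetP=> Y /shadowP[x xY]; rewrite !in_shift.
have inS W : x |: Y \in F -> Y \in shadow F by move=> H; apply/shadowP; exists x.
case iY: (i \in Y).
  rewrite in_setU1 iY orbT => /orP[/inS-> //|/(shadow_swap xY)->].
  by rewrite orbT.
rewrite in_setU1 iY orbF; have [<-|nix] := eqVneq i x; last first.
  by case/andP => /inS -> // /(shadow_swap xY) ->.
case jY: (j \in Y).
  (* x = i and j in Y: both i |: Y and its image under the swap restrict to Y and swap Y *)
  rewrite swap_id; last by rewrite !in_setU1 eqxx jY orbT.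
  rewrite orbb => H; apply/andP; split; first by apply/shadowP; exists i; rewrite ?iY.
  apply: (@shadow_swap _ _ _ _ i); rewrite ?iY //.
  by rewrite swap_id // !in_setU1 eqxx jY orbT.
rewrite (swap_id (X := Y)) ?iY ?jY // andbb.
case/orP => [H|/(@shadow_swap _ _ _ _ i)]; first by apply/shadowP; exists i; rewrite ?iY.
by rewrite iY (swap_id (X := Y)) ?iY ?jY // => ->.
Qed.

Lemma card_shadow_shift i j F : #|shadow (shift i j F)| <= #|shadow F|.
Proof. by rewrite -(card_shift i j (shadow F)) subset_leq_card ?shadow_shift. Qed.

Definition avoid i F : {set {set T}} := [set X in F | i \notin X].
Definition link i F : {set {set T}} := [set X : {set T} | (i \notin X) && (i |: X \in F)].

Lemma card_link_avoid i F : (#|link i F| + #|avoid i F|)%N = #|F|.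
Proof.
have -> : link i F = (fun X : {set T} => X :\ i) @: [set X in F | i \in X].
  apply/setP=> X; apply/idP/imsetP => [|[Y]]; rewrite inE.
    case/andP=> iX iXF; exists (i |: X); first by rewrite inE iXF setU11.
    by rewrite setU1K.
  by move=> /andP[YF iY] ->; rewrite inE setD1K // YF setD11.
rewrite card_in_imset.
  rewrite -(cardsID [set X : {set T} | i \in X] F); congr (_ + _)%N.
    by apply: eq_card => X; rewrite !inE.
  by apply: eq_card => X; rewrite !inE andbC.
move=> X Y; rewrite !inE => /andP[_ iX] /andP[_ iY] eq.
by rewrite -(setD1K iX) eq setD1K.
Qed.

Lemma uniform_avoid S r i F : uniform_on S r F -> uniform_on (S :\ i) r (avoid i F).
Proof.
move=> FU X; rewrite inE => /andP[/FU[XS ->] iX]; split=> //.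
by rewrite subsetD1 XS.
Qed.

Lemma uniform_link S r i F :
  uniform_on S r.+1 F -> uniform_on (S :\ i) r (link i F).
Proof.
move=> FU X; rewrite inE => /andP[iX /FU[]]; rewrite cardsU1 iX add1n => XS [->].
by split=> //; rewrite subsetD1 iX andbT; apply: subset_trans XS; rewrite subsetUr.
Qed.

Lemma card_link_shadow i F : #|link i F| + #|shadow (link i F)| <= #|shadow F|.
Proof.
have inj : {in shadow (link i F) &, injective (fun Y => i |: Y)}.
  have iN Y : Y \in shadow (link i F) -> i \notin Y.
    by case/shadowP=> x xY; rewrite inE in_setU1 negb_or => /andP[/andP[_ ->]].
  by move=> Y Z /iN iY /iN iZ eq; rewrite -(setU1K iY) eq setU1K.
rewrite -(card_in_imset inj) -cardsUI.
rewrite [X in _ + X <= _](_ : _ = 0) ?addn0; last first.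
  apply/eqP; rewrite cards_eq0; apply/eqP/setP=> Y; rewrite !inE.
  by apply/negP => /andP[/andP[iY _]] /imsetP[Z _ eq]; rewrite eq setU11 in iY.
apply: subset_leq_card; apply/subsetP=> Y; rewrite in_setU => /orP[].
  by rewrite inE => /andP[iY H]; apply/shadowP; exists i.
case/imsetP=> Z /shadowP[x xZ]; rewrite inE in_setU1 negb_or => /andP[/andP[nix iZ] H] ->.
apply/shadowP; exists x; first by rewrite in_setU1 negb_or eq_sym nix.
by rewrite setUCA.
Qed.

Definition stable i S F := [forall j in S, shift i j F == F].

Lemma shadow_avoid_sub S r i F :
  uniform_on S r F -> stable i S F -> shadow (avoid i F) \subset link i F.
Proof.
move=> FU /forall_inP st; apply/subsetP=> Y /shadowP[x xY].
rewrite inE => /andP[xYF]; rewrite in_setU1 negb_or => /andP[nix iY].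
have xS : x \in S by have [/subsetP->] := FU _ xYF; rewrite ?setU11.
rewrite inE iY -(eqP (st x xS)) in_shift setU11; apply/orP; right.
by rewrite swap_setU1 tpermL swap_id // (negPf iY) (negPf xY).
Qed.

Lemma card_avoid_shift i j F :
  shift i j F != F -> #|avoid i (shift i j F)| < #|avoid i F|.
Proof.
move=> neq; apply: proper_card; apply/properP; split.
  apply/subsetP=> X; rewrite !inE => /andP[+ iX].
  by rewrite (negPf iX) => /andP[-> _].
apply/exists_inP; apply: contraNT neq; rewrite negb_exists_in => /forall_inP H.
have av X : i \notin X -> X \in F -> swap i j X \in F.
  move=> iX XF; have := H X; rewrite !inE XF iX /= => /(_ isT).
  by rewrite negbK (negPf iX) andbT.
apply/eqP/setP=> X; rewrite in_shift; case: ifPn => iX; last first.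
  by case XF: (X \in F) => //=; rewrite (av X).
case XF: (X \in F) => //=; apply/negbTE; apply/negP => sF; case jX: (j \in X).
  by rewrite swap_id ?iX ?jX ?XF in sF.
have := av (swap i j X); rewrite swapK in_swap tpermL jX XF => /(_ isT sF).
by [].
Qed.

Lemma shift_ind i S (P : {set {set T}} -> Prop) :
  (forall F, stable i S F -> P F) ->
  (forall F j, j \in S -> P (shift i j F) -> P F) ->
  forall F, P F.
Proof.
move=> Pst Psh F; have [m] := ubnP #|avoid i F|; elim: m F => // m IHm F lt_m.
have [/Pst //|] := boolP (stable i S F).
rewrite negb_forall => /existsP[j]; rewrite negb_imply => /andP[jS neq].
by apply: (Psh F j jS); apply: IHm; apply: leq_trans (card_avoid_shift neq) _.
Qed.

(** * Kruskal-Katona in cascade form *)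

(* 'C(a1, r) + 'C(a2, r - 1) + ...; whatever follows the term of lower index 0 is ignored. *)
Fixpoint casc r s {struct s} :=
  if s is a :: s' then 'C(a, r) + (if r is r'.+1 then casc r' s' else 0) else 0.

Fixpoint valid_casc b r s {struct s} :=
  if s is a :: s' then
    (r <= a < b) && (if r is r'.+1 then valid_casc a r' s' else true)
  else true.

Lemma valid_casc_le b r r' s : r' <= r -> valid_casc b r s -> valid_casc b r' s.
Proof.
elim: s b r r' => [|a s IHs] b r r' //= le /andP[/andP[ra ab] H].
rewrite ab (leq_trans le ra) /=; case: r' le => // r'; case: r H {ra} => // r H le; exact: IHs H.
Qed.

Lemma casc_pascal b r s : valid_casc b r.+1 s ->
  casc r.+1 s = casc r.+1 (map predn s) + casc r (map predn s).
Proof.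
elim: s b r => [|[|a] s IHs] b r //= /andP[/andP[ra _] H].
rewrite binS /=.
case: r ra H => [|r] _ H; last by rewrite (IHs a.+1) //; lia.
by case: s {IHs H} => [|c s] /=; rewrite !bin0; lia.
Qed.

Lemma casc_pred_le b r s :
  b <= r.+2 -> valid_casc b r.+1 s -> casc r (map predn s) <= r.+1.
Proof.
elim: s b r => [|a s IHs] b r //= le /andP[/andP[ra ab] H].
have {ab ra} ra : a = r.+1 by lia.
rewrite {}ra in H *; rewrite /= binn add1n ltnS.
case: r le H => [|r] le H //=; exact: IHs H.
Qed.

Lemma valid_casc_leq b b' r s : b <= b' -> valid_casc b r s -> valid_casc b' r s.
Proof.
by case: s => //= a s le /andP[/andP[-> ab] ->]; rewrite (leq_trans ab le).
Qed.

Lemma casc_gt b r s n :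
  r.+2 < b -> valid_casc b r.+1 s -> casc r.+1 (map predn s) < n ->
  exists s', [/\ valid_casc b.-1 r.+1 s', casc r.+1 s' <= n
               & casc r (map predn s) <= casc r s'].
Proof.
elim: s b r n => [|a s IHs] b r n /=.
  by move=> _ _ _; exists [::].
move=> rb /andP[/andP[ra ab] H] lt.
move: ra; rewrite leq_eqVlt => /orP[/eqP ea|ra].
  exists [:: r.+1] => /=; split; first by case: (r) rb => [|r'] rb; rewrite andbT; lia.
    by rewrite binn; case: (r); lia.
  have -> : 'C(r.+1, r) + match r with 0 => 0 | _.+1 => 0 end = r.+1.
    by rewrite binSn; case: (r) => [|?]; rewrite addn0.
  have := @casc_pred_le r.+2 r (a :: s); rewrite /= -ea !leqnn /=.
  by apply; rewrite // ea.
case: r rb ra H lt => [|r] rb ra H lt.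
  exists [:: a.-1] => /=; split; [lia| |].
    by case: s {IHs H} lt => [|c s] /=; rewrite ?bin0; lia.
  by case: s {IHs H} lt => [|c s] /=; rewrite ?bin0; lia.
have [||s' [v' le1 le2]] := IHs a r (n - 'C(a.-1, r.+2)) _ H; try lia.
by exists (a.-1 :: s') => /=; split; [rewrite v' andbT; lia | lia | lia].
Qed.

Theorem kruskal_katona S r F b s :
  uniform_on S r.+1 F -> valid_casc b r.+1 s -> casc r.+1 s <= #|F| ->
  casc r s <= #|shadow F|.
Proof.
have [m] := ubnP #|S|; elim: m S r F b s => // m IHm S r F b s ltS.
have [->|[i iS]] := set_0Vmem S.
  move=> FU; have -> : F = set0.
    apply/setP=> X; rewrite inE; apply/negP => /FU[].
    by rewrite subset0 => /eqP->; rewrite cards0.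
  rewrite cards0; case: s => [//|a s] /= /andP[/andP[ra _] _].
  by have := ra; rewrite -bin_gt0; lia.
have ltS' : #|S :\ i| < m by move: ltS; rewrite (cardsD1 i S) iS; lia.
pattern F; apply: (@shift_ind i S) => {}F; last first.
  move=> j jS IH FU vs; rewrite -(card_shift i j F) => le.
  exact: leq_trans (IH (uniform_shift iS jS FU) vs le) (card_shadow_shift _ _ _).
move=> st FU vs; rewrite -(card_link_avoid i) (casc_pascal vs) => le.
(* Frankl's argument: otherwise the members avoiding i are so many that their shadow, which
   stability puts inside the link, is already too large. *)
have link_ge : casc r (map predn s) <= #|link i F|.
  have [//|lt] := leqP (casc r (map predn s)) #|link i F|.
  have {le} le : casc r.+1 (map predn s) < #|avoid i F| by lia.
  have [s' [vs' le1 le2]] :=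
    casc_gt (leq_maxr b r.+3) (valid_casc_leq (leq_maxl b r.+3) vs) le.
  have := IHm _ _ _ _ _ ltS' (uniform_avoid FU) vs' le1.
  by have := subset_leq_card (shadow_avoid_sub FU st); lia.
apply: leq_trans (card_link_shadow i F).
have vp r' : valid_casc b r'.+1 s -> valid_casc b.-1 r' (map predn s).
  clear; elim: s b r' => //= a s IHs b r' /andP[/andP[ra ab]].
  case: r' ra => [|r'] ra H; first by rewrite andbT; lia.
  by rewrite IHs // andbT; lia.
case: r FU vs link_ge {le st} => [|r] FU vs link_ge.
  by case: s link_ge {vs vp} => [|a s] //=; rewrite !bin0; lia.
rewrite (@casc_pascal b r s) ?(valid_casc_le _ vs) //.
apply: leq_add => //.
exact: IHm ltS' (uniform_link FU) (vp _ vs) link_ge.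
Qed.

Lemma kruskal_katona_bin S r F a :
  uniform_on S r.+1 F -> r < a -> 'C(a, r.+1) <= #|F| -> 'C(a, r) <= #|shadow F|.
Proof.
move=> FU ra le; have := @kruskal_katona S r F a.+1 [:: a] FU.
rewrite /= ra ltnSn addn0 => /(_ isT le).
by case: (r) => [|?]; rewrite addn0.
Qed.

Lemma iter_shadow_casc S l m F b s :
  uniform_on S (m + l) F -> valid_casc b (m + l) s -> casc (m + l) s <= #|F| ->
  casc l s <= #|iter m shadow F|.
Proof.
elim: m F => [//|m IHm] F; rewrite addSn => FU vs le; rewrite iterSr.
apply: IHm; first exact: uniform_shadow.
  exact: valid_casc_le vs.
exact: kruskal_katona FU vs le.
Qed.

Lemma uniform_iter_shadow S l m F :
  uniform_on S (m + l) F -> uniform_on S l (iter m shadow F).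
Proof.
elim: m F => [//|m IHm] F; rewrite addSn => FU; rewrite iterSr.
by apply: IHm; apply: uniform_shadow.
Qed.

Lemma iter_shadow_sub m F Y :
  Y \in iter m shadow F -> exists2 X, X \in F & Y \subset X.
Proof.
elim: m Y => [|m IHm] Y /=; first by exists Y.
case/shadowP=> x _ /IHm[X XF sub]; exists X => //.
exact: subset_trans (subsetUr _ _) sub.
Qed.

(** * Uniqueness of the extremal families *)

Implicit Types (D E : {set T}) (z w : T).

Lemma avoiding_family S r F N x :
  #|S| = N.+1 -> x \in S -> uniform_on S r F -> #|F| = 'C(N, r) ->
  (forall X, X \in F -> x \notin X) ->
  F = [set X : {set T} | (X \subset S :\ x) && (#|X| == r)].
Proof.
move=> cS xS FU cF av; apply/eqP; rewrite eqEcard cards_draws cF.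
have -> : #|S :\ x| = N by move: cS; rewrite (cardsD1 x) xS => -[].
rewrite leqnn andbT; apply/subsetP=> X XF; rewrite inE.
by have [XS ->] := FU X XF; rewrite eqxx subsetD1 XS av.
Qed.

Lemma exchange_ind S r (P : {set T} -> Prop) :
  (forall E z w, z \notin E -> w \notin E -> z |: E \subset S -> w |: E \subset S ->
     #|z |: E| = r -> P (z |: E) -> P (w |: E)) ->
  forall D D', D \subset S -> D' \subset S -> #|D| = r -> #|D'| = r -> P D -> P D'.
Proof.
move=> step D D'; have [m] := ubnP #|D' :\: D|.
elim: m D => // m IHm D ltm DS D'S cD cD' PD.
have [sub|] := boolP (D' \subset D).
  suff -> : D' = D by [].
  by apply/eqP; rewrite eqEcard sub cD cD' leqnn.
case/subsetPn=> w wD' wD.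
have /subsetPn[z zD zD'] : ~~ (D \subset D').
  apply: contra wD => sub; suff <- : D' = D by [].
  by apply/esym/eqP; rewrite eqEcard sub cD cD' leqnn.
have DE := setD1K zD.
have wE : w \notin D :\ z by rewrite !inE negb_and wD orbT.
have wES : w |: D :\ z \subset S.
  rewrite subUset sub1set (subsetP D'S) //=; apply: subset_trans DS.
  exact: subD1set.
have cE : #|w |: D :\ z| = r.
  by rewrite cardsU1 wE -cD (cardsD1 z D) zD.
apply: (IHm (w |: D :\ z)) => //; last first.
  by apply: (step _ z) => //; rewrite ?DE // setD11.
rewrite -ltnS; apply: leq_trans ltm; rewrite ltnS.
apply: proper_card; apply/properP; split.
  apply/subsetP=> y; rewrite !inE !negb_or => /andP[/andP[_]] + yD'.
  rewrite yD' andbT negb_and negbK => /orP[/eqP eyz|->//].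
  by rewrite eyz (negPf zD') in yD'.
by exists w; rewrite !inE ?wD ?wD' ?eqxx.
Qed.

Lemma mem_shift i j F X :
  X \in F -> (X \in shift i j F) || (swap i j X \in shift i j F).
Proof.
move=> XF; rewrite !in_shift swapK in_swap tpermL XF orbT /=.
case: ifPn => //= iX; case: ifPn => [|jX]; first by rewrite orbT.
by rewrite swap_id ?XF // (negPf iX) (negPf jX).
Qed.

Lemma unshift_avoid S N r F i j :
  #|S| = N.+1 -> i \in S -> j \in S -> r < N -> uniform_on S r.+1 F ->
  #|F| = 'C(N, r.+1) -> #|shadow F| <= 'C(N, r) ->
  (exists2 x, x \in S & forall X, X \in shift i j F -> x \notin X) ->
  exists2 x, x \in S & forall X, X \in F -> x \notin X.
Proof.
move=> cS iS jS rN FU cF cdF [x xS av].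
have shE := avoiding_family cS xS (uniform_shift iS jS FU)
  (etrans (card_shift i j F) cF) av.
have [eij|nij] := eqVneq i j.
  exists x => // X /(mem_shift i j).
  by rewrite swap_id ?orbb; [apply: av | rewrite eij].
have [exi|nxi] := eqVneq x i.
  exists i => // X XF; apply/negP => iX; have := av X.
  by rewrite in_shift iX XF exi iX => /(_ isT).
have [exj|nxj] := eqVneq x j; last first.
  exists x => // X /(mem_shift i j) /orP[|] /av //.
  by rewrite in_swap tpermD // 1?eq_sym.
subst x.
have shadowE : shift i j (shadow F) = shadow (shift i j F).
  apply/esym/eqP; rewrite eqEcard shadow_shift card_shift (leq_trans cdF) //.
  apply: kruskal_katona_bin (uniform_shift iS jS FU) rN _.
  by rewrite card_shift cF.
have shadow_av Y : Y \in shadow F -> i |: Y :\ j \in shadow F -> i \notin Y -> j \notin Y.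
  move=> YF sYF iY; apply/negP => jY.
  have : Y \in shift i j (shadow F) by rewrite in_shift (negPf iY) YF swapU1.
  rewrite shadowE => /shadowP[z zY /av]; by rewrite in_setU1 jY orbT.
set S' := S :\ i :\ j.
have S'P D : D \subset S' -> [/\ D \subset S, i \notin D & j \notin D].
  by rewrite !subsetD1 => /andP[/andP[-> ->] ->].
have dich D : D \subset S' -> #|D| = r -> (i |: D \in F) (+) (j |: D \in F).
  move=> /S'P[DS iD jD] cD.
  have jiD : j \notin i |: D by rewrite in_setU1 eq_sym (negPf nij).
  have ijD : i \notin j |: D by rewrite in_setU1 (negPf nij).
  have sE : swap i j (i |: D) = j |: D.
    by rewrite swap_setU1 tpermL swap_id // (negPf iD) (negPf jD).
  have : i |: D \in shift i j F.
    rewrite shE inE subsetD1 jiD subUset sub1set iS DS cardsU1 iD cD /=.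
    by rewrite add1n.
  rewrite in_shift setU11 sE.
  have : j |: D \notin shift i j F by apply/negP => /av; rewrite setU11.
  by rewrite in_shift (negPf ijD) -sE swapK; do 2?case: (_ \in F).
have step E z w : z \notin E -> w \notin E -> z |: E \subset S' -> w |: E \subset S' ->
    #|z |: E| = r -> i |: (z |: E) \in F -> i |: (w |: E) \in F.
  move=> zE wE zES wES cE zF.
  have [[_ izE jzE] [_ iwE jwE]] := (S'P _ zES, S'P _ wES).
  have := dich _ wES; rewrite cardsU1 wE -cE cardsU1 zE => /(_ erefl).
  case: (i |: (w |: E) \in F) => //= wF.
  move: izE jzE iwE jwE; rewrite !in_setU1 !negb_or.
  move=> /andP[iz iE] /andP[jz jE] /andP[iw _] /andP[jw _].
  suff : j \notin j |: E by rewrite setU11.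
  apply: shadow_av.
  - apply/shadowP; exists w; first by rewrite in_setU1 negb_or eq_sym jw.
    by rewrite setUCA.
  - rewrite setU1K //; apply/shadowP; exists z; first by rewrite in_setU1 negb_or eq_sym iz.
    by rewrite setUCA.
  - by rewrite in_setU1 negb_or nij.
have no_ij X : X \in F -> i \in X -> j \notin X.
  by move=> XF iX; apply: av; rewrite in_shift iX XF.
have decomp X y : X \in F -> y \in X -> (X :\ y \subset S) && (#|X :\ y| == r).
  move=> /FU[XS cX] yX; rewrite (subset_trans (subD1set _ _) XS) /=.
  by move: cX; rewrite (cardsD1 y) yX add1n => -[->].
have [/exists_inP[X XF iX]|] := boolP [exists X in F, i \in X]; last first.
  rewrite negb_exists_in => /forall_inP avi; by exists i.
exists j => // Y YF; apply/negP => jY.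
have iY : i \notin Y by apply: contraTN jY; apply: no_ij.
have /andP[XS /eqP cX] := decomp _ _ XF iX; have /andP[YS /eqP cY] := decomp _ _ YF jY.
have XS' : X :\ i \subset S'.
  by rewrite !subsetD1 XS setD11 /= !inE negb_and (no_ij X) ?orbT.
have YS' : Y :\ j \subset S'.
  by rewrite !subsetD1 YS setD11 /= !inE negb_and iY !orbT.
have := @exchange_ind S' r (fun D => i |: D \in F) step (X :\ i) (Y :\ j).
rewrite setD1K // => /(_ XS' YS' cX cY XF) H.
by have := dich _ YS' cY; rewrite setD1K // YF H.
Qed.

Lemma shadow_extremal S N r F :
  #|S| = N.+1 -> uniform_on S r.+1 F ->
  #|F| = 'C(N, r.+1) -> #|shadow F| <= 'C(N, r) ->
  exists2 x, x \in S & forall X, X \in F -> x \notin X.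
Proof.
elim: N S r F => [|N IHN] S r F cS FU cF cdF.
  have /eqP/cards1P[x ->] := cS; exists x; rewrite ?set11 // => X.
  by move/eqP: cF; rewrite bin0n cards_eq0 => /eqP->; rewrite inE.
have [i iS] : exists i, i \in S by apply/set0Pn; rewrite -card_gt0 cS.
have [leNr|ltrN] := leqP N.+1 r.
  exists i => // X; suff -> : F = set0 by rewrite inE.
  by apply/eqP; rewrite -cards_eq0 cF bin_small.
have [eNr|ltrN'] := eqVneq r N.
  rewrite eNr binn in cF; have /eqP/cards1P[X eF] := cF.
  have [XS cX] : X \subset S /\ #|X| = r.+1 by apply: FU; rewrite eF set11.
  have /subsetPn[x xS xX] : ~~ (S \subset X).
    by apply/negP => /subset_leq_card; rewrite cS cX eNr ltnn.
  by exists x => // Y; rewrite eF inE => /eqP->.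
have {ltrN ltrN'} rN : r < N by rewrite ltn_neqAle ltrN' -ltnS.
move: FU cF cdF; pattern F; apply: (@shift_ind i S) => {}F; last first.
  move=> j jS IH FU cF cdF.
  apply: (@unshift_avoid S N.+1 r F i j) => //; first exact: ltnW.
  apply: IH; first exact: uniform_shift.
    by rewrite card_shift.
  exact: leq_trans (card_shadow_shift _ _ _) cdF.
move=> st FU cF cdF.
have cS' : #|S :\ i| = N.+1 by move: cS; rewrite (cardsD1 i) iS => -[].
have avsub := subset_leq_card (shadow_avoid_sub FU st).
have cFE : #|link i F| + #|avoid i F| = 'C(N, r.+1) + 'C(N, r).
  by rewrite card_link_avoid cF binS.
have link_ge : 'C(N, r) <= #|link i F|.
  rewrite leqNgt; apply/negP => lt.
  have : 'C(N, r) <= #|shadow (avoid i F)|.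
    by apply: kruskal_katona_bin (uniform_avoid FU) rN _; lia.
  by lia.
have link_le : #|link i F| <= 'C(N, r).
  case: r rN FU cF cdF {avsub} cFE link_ge => [|r] rN FU cF cdF cFE link_ge.
    rewrite bin0; apply: (@leq_trans #|[set (set0 : {set T})]|); last by rewrite cards1.
    apply: subset_leq_card; apply/subsetP => X /(uniform_link FU)[_ /eqP].
    by rewrite cards_eq0 inE.
  have := card_link_shadow i F; have := kruskal_katona_bin (uniform_link FU) (ltnW rN) link_ge.
  by move: cdF; rewrite binS; lia.
have cA : #|avoid i F| = 'C(N, r.+1) by lia.
have [x xS av] := IHN _ _ _ cS' (uniform_avoid FU) cA (leq_trans avsub link_le).
exists x; first by case/setD1P: xS.
have AE := avoiding_family cS' xS (uniform_avoid FU) cA av.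
have sub : [set Y : {set T} | (Y \subset S :\ i :\ x) && (#|Y| == r)] \subset link i F.
  apply/subsetP=> Y; rewrite inE => /andP[YS /eqP cY].
  apply: (subsetP (shadow_avoid_sub FU st)).
  have /subsetPn[z zS zY] : ~~ (S :\ i :\ x \subset Y).
    apply/negP => /subset_leq_card; rewrite cY.
    by move: cS'; rewrite (cardsD1 x) xS; lia.
  apply/shadowP; exists z => //.
  by rewrite AE inE subUset sub1set zS YS cardsU1 zY cY /= add1n.
have linkE : [set Y : {set T} | (Y \subset S :\ i :\ x) && (#|Y| == r)] = link i F.
  apply/eqP; rewrite eqEcard sub cards_draws.
  suff -> : #|S :\ i :\ x| = N by [].
  by move: cS'; rewrite (cardsD1 x) xS; lia.
have nix : x != i by case/setD1P: xS.
move=> X XF; have [iX|iX] := boolP (i \in X); last by apply: av; rewrite inE XF.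
have : X :\ i \in link i F by rewrite inE setD11 setD1K.
rewrite -linkE inE subsetD1 => /andP[/andP[_ +] _].
by rewrite !inE nix.
Qed.

End Families.

(** * Cross-intersecting families *)

Lemma card_layer n k : #|layer n k| = 'C(n, k).
Proof. by rewrite card_draws card_ord. Qed.

Lemma card_star n k (i : 'I_n) : #|[set X in layer n k.+1 | i \in X]| = 'C(n.-1, k).
Proof.
have -> : [set X in layer n k.+1 | i \in X] =
          (fun X : {set 'I_n} => i |: X)
            @: [set X : {set 'I_n} | X \subset [set: 'I_n] :\ i & #|X| == k].
  apply/setP=> X; apply/idP/imsetP => [|[Y]]; rewrite !inE.
    move=> /andP[/eqP cX iX]; exists (X :\ i); last by rewrite setD1K.
    rewrite inE subsetD1 subsetT setD11 /=.
    by move: cX; rewrite (cardsD1 i) iX add1n => -[->].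
  rewrite subsetD1 => /andP[/andP[_ iY] /eqP <-] ->.
  by rewrite setU11 cardsU1 iY add1n eqxx.
rewrite card_in_imset.
  rewrite cards_draws; congr 'C(_, _).
  by have := cardsD1 i [set: 'I_n]; rewrite inE cardsT card_ord add1n => /(congr1 predn) ->.
move=> X Y; rewrite !inE !subsetD1 => /andP[/andP[_ iX] _] /andP[/andP[_ iY] _] eq.
by rewrite -(setU1K iX) eq setU1K.
Qed.

Lemma star_le_max_cross n k l : 0 < n -> 0 < k -> 0 < l ->
  'C(n.-1, k.-1) * 'C(n.-1, l.-1) <= max_cross n k l.
Proof.
case: n k l => [|n] [|k] [|l] // _ _ _.
pose star m := [set X in layer n.+1 m | ord0 \in X].
have starP : [&& star k.+1 \subset layer n.+1 k.+1, star l.+1 \subset layer n.+1 l.+1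
               & cross_intersecting (star k.+1) (star l.+1)].
  apply/and3P; split; try by apply/subsetP => X; rewrite inE => /andP[].
  apply/forall_inP => X; rewrite inE => /andP[_ iX].
  apply/forall_inP => Y; rewrite inE => /andP[_ iY].
  by apply/set0Pn; exists ord0; rewrite inE iX.
rewrite -(card_star k (ord0 : 'I_n.+1)) -(card_star l (ord0 : 'I_n.+1)).
exact: (@leq_bigmax_cond _ _
  (fun p : {set {set 'I_n.+1}} * {set {set 'I_n.+1}} => #|p.1| * #|p.2|)
  (star k.+1, star l.+1) starP).
Qed.

Lemma cross_intersecting_sym n (A B : {set {set 'I_n}}) :
  cross_intersecting A B -> cross_intersecting B A.
Proof.
move=> /forall_inP AB; apply/forall_inP => Y YB; apply/forall_inP => X XA.
by rewrite setIC; have /forall_inP := AB X XA; apply.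
Qed.

Section CrossIntersecting.
Variables (n k l : nat) (A B : {set {set 'I_n}}).
Hypotheses (Ak : A \subset layer n k) (Bl : B \subset layer n l).
Hypothesis (AB : cross_intersecting A B).

Let F : {set {set 'I_n}} := (@setC _) @: A.

Let cF : #|F| = #|A|.
Proof. by rewrite card_imset //; apply: setC_inj. Qed.

Let FU : uniform_on [set: 'I_n] (n - k) F.
Proof.
move=> _ /imsetP[X XA ->]; split; first exact: subsetT.
by have := subsetP Ak X XA; rewrite inE => /eqP <-; rewrite [LHS]cardsCs setCK card_ord.
Qed.

Let not_below X Y : X \in F -> Y \in B -> ~~ (Y \subset X).
Proof.
case/imsetP=> {}X XA -> YB; rewrite -disjoints_subset -setI_eq0 setIC.
by move/forall_inP: AB => /(_ X XA)/forall_inP/(_ Y YB).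
Qed.

Let card_B m (G : {set {set 'I_n}}) : uniform_on [set: 'I_n] (m + l) G ->
  (forall X, X \in G -> exists2 Z, Z \in F & X \subset Z) ->
  #|iter m (@shadow _) G| + #|B| <= 'C(n, l).
Proof.
move=> GU GF; rewrite -card_layer -cardsUI.
rewrite [X in _ + X](_ : _ = 0) ?addn0; last first.
  apply/eqP; rewrite cards_eq0; apply/eqP/setP=> Y; rewrite !inE; apply/negP.
  case/andP=> /iter_shadow_sub[X /GF[Z ZF XZ] YX].
  by apply/negP; apply: contraL (subset_trans YX XZ) => YB; apply: not_below.
apply: subset_leq_card; rewrite subUset Bl andbT; apply/subsetP=> Y.
by move=> /(uniform_iter_shadow GU)[_ cY]; rewrite inE cY.
Qed.

Lemma cross_card b s : k + l <= n -> valid_casc b (n - k) s -> casc (n - k) s <= #|A| ->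
  casc l s + #|B| <= 'C(n, l).
Proof.
move=> kln vs; rewrite -cF.
have e : n - k = (n - k - l) + l by lia.
have FU' := FU; rewrite e in vs FU' *; move=> le.
have := card_B FU' (fun X XF => ex_intro2 _ _ X XF (subxx X)).
by apply: leq_trans; rewrite leq_add2r; apply: iter_shadow_casc FU' vs le.
Qed.

Lemma cross_extremal : 0 < k -> 0 < l -> k + l < n ->
  #|A| = 'C(n.-1, k.-1) -> #|B| = 'C(n.-1, l.-1) ->
  exists i : 'I_n, A = [set X in layer n k | i \in X] /\
                   B = [set Y in layer n l | i \in Y].
Proof.
move=> k0 l0 kln cA cB; have e : n - k = (n - k).-1.+1 by lia.
set r := (n - k).-1 in e.
have en : n = n.-1.+1 by lia.
have FU' := FU; rewrite e in FU'.
have cF' : #|F| = 'C(n.-1, r.+1) by rewrite cF cA -bin_sub; [congr 'C(_, _); lia|lia].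
have cdF : #|shadow F| <= 'C(n.-1, r).
  rewrite leqNgt; apply/negP => lt.
  have er : r = (r - l) + l by lia.
  have := uniform_shadow FU'; rewrite er => SU.
  have dF X : X \in shadow F -> exists2 Z, Z \in F & X \subset Z.
    by move/(@iter_shadow_sub _ 1).
  have := card_B SU dF.
  have := @iter_shadow_casc _ _ _ _ _ n [:: n.-1; r.-1] SU.
  rewrite -er.
  have [r' er'] : exists r', r = r'.+1 by exists r.-1; lia.
  have [l' el'] : exists l', l = l'.+1 by exists l.-1; lia.
  have : 0 < 'C(r', l') by rewrite bin_gt0; lia.
  have pas : 'C(n, l) = 'C(n.-1, l) + 'C(n.-1, l') by rewrite {1}en el' binS.
  rewrite pas {pas} /= cB el' er' /= binn in lt * => b0.
  have -> : r' < n.-1 < n by lia.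
  have -> : (r' <= r' < n.-1) && match r' with 0 => true | _.+1 => true end.
    by apply/andP; split; [apply/andP; split=> //; lia | case: (r')].
  have -> : match r' with 0 => 0 | _.+1 => 0 end = 0 by case: (r').
  have -> : match l' with 0 => 0 | _.+1 => 0 end = 0 by case: (l').
  move=> /(_ isT); rewrite !addn0 => H1 H2.
  by have := H1 _; lia.
have cT : #|[set: 'I_n]| = n.-1.+1 by rewrite cardsT card_ord.
have [x _ av] := shadow_extremal cT FU' cF' cdF.
have FE := avoiding_family cT (in_setT x) FU' cF' av.
exists x.
have Astar : A \subset [set X in layer n k | x \in X].
  apply/subsetP=> X XA; rewrite inE (subsetP Ak) //=.
  by have := av (~: X) (imset_f _ XA); rewrite inE negbK.
have Bstar : B \subset [set Y in layer n l | x \in Y].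
  apply/subsetP=> Y YB; rewrite inE (subsetP Bl) //=; apply: contraT => xY.
  have cY : #|Y| = l by have := subsetP Bl Y YB; rewrite inE => /eqP.
  have : 0 < #|[set X : {set 'I_n} | X \subset ~: (x |: Y) & #|X| == k.-1]|.
    by rewrite cards_draws bin_gt0 cardsCs setCK card_ord cardsU1 xY cY; lia.
  case/card_gt0P=> X; rewrite inE subsetC subUset sub1set in_setC.
  move=> /andP[/andP[xX YX] /eqP cX].
  have : ~: (x |: X) \in F.
    rewrite FE inE subsetD1 subsetT in_setC setU11 cardsCs setCK card_ord cardsU1 xX cX /=.
    by apply/eqP; lia.
  move=> /not_below/(_ YB); rewrite subsetC subUset sub1set in_setC xY /=.
  by rewrite subsetC YX.
move: cA cB Astar Bstar; case: (k) k0 => // k' _; case: (l) l0 => // l' _ cA cB Astar Bstar.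
by split; apply/eqP; rewrite eqEcard ?Astar ?Bstar card_star ?cA ?cB /=.
Qed.

End CrossIntersecting.

Fixpoint word_low N r (w : seq bool) : nat :=
  if w is b :: w' then
    if b then 'C(N.-1, r) + word_low N.-1 r.-1 w' else word_low N.-1 r w'
  else 0.

Fixpoint word_width N r (w : seq bool) : nat :=
  if w is b :: w' then word_width N.-1 (if b then r.-1 else r) w' else 'C(N, r).

Fixpoint word_list N (w : seq bool) : seq nat :=
  if w is b :: w' then
    if b then N.-1 :: word_list N.-1 w' else word_list N.-1 w'
  else [::].

Lemma casc_word_list N r w : size w <= r -> casc r (word_list N w) = word_low N r w.
Proof.
elim: w N r => [|[] w IHw] N r //= szw; last by apply: IHw; lia.
by case: r szw => [//|r] szw; rewrite IHw.
Qed.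

Lemma valid_word_list N r w : size w + r <= N -> valid_casc N r (word_list N w).
Proof.
elim: w N r => [|b w IHw] N r //= szw.
case: b => /=; last by apply: valid_casc_leq (leq_pred N) (IHw _ _ _); lia.
apply/andP; split; first by lia.
by case: r szw => [//|r] szw; apply: IHw; lia.
Qed.

Lemma word_exists D N r f : D <= r -> D + r <= N -> f <= 'C(N, r) ->
  exists w : D.-tuple bool, word_low N r w <= f <= word_low N r w + word_width N r w.
Proof.
elim: D N r f => [|D IHD] N r f Dr DN fN; first by exists [tuple]; rewrite leq0n.
have pas : 'C(N, r) = 'C(N.-1, r) + 'C(N.-1, r.-1).
  by case: N r Dr DN {fN} => [|N] [|r] // _ _; rewrite ?binS //; lia.
have [le|lt] := leqP f 'C(N.-1, r).
  have [||w wP] := IHD N.-1 r f _ _ le; [lia|lia|].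
  by exists [tuple of false :: w].
have [|||w wP] := IHD N.-1 r.-1 (f - 'C(N.-1, r)); [lia|lia|lia|].
by exists [tuple of true :: w] => /=; lia.
Qed.

Lemma cross_key n k l (A B : {set {set 'I_n}}) s :
  A \subset layer n k -> B \subset layer n l -> cross_intersecting A B ->
  0 < k -> 0 < l -> k + l < n ->
  valid_casc n.-1 (n - k).-1 s -> 'C(n.-1, k.-1) + casc (n - k).-1 s <= #|A| ->
  casc l.-1 s + #|B| <= 'C(n.-1, l.-1).
Proof.
move=> Ak Bl AB k0 l0 kln vs le.
have e : n - k = (n - k).-1.+1 by lia.
have kln' : k + l <= n by lia.
have := @cross_card n k l A B Ak Bl AB n (n.-1 :: s) kln'.
have -> : valid_casc n (n - k) (n.-1 :: s).
  by rewrite e /= vs andbT; lia.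
have -> : casc (n - k) (n.-1 :: s) = 'C(n.-1, k.-1) + casc (n - k).-1 s.
  rewrite {1}e /= -e; congr (_ + _).
  rewrite -bin_sub; last by lia.
  by congr 'C(_, _); lia.
have -> : 'C(n, l) = 'C(n.-1, l) + 'C(n.-1, l.-1).
  by case: (n) (l) l0 kln => [|n'] [|l'] // _; rewrite ?binS //; lia.
have -> : casc l (n.-1 :: s) = 'C(n.-1, l) + casc l.-1 s by case: (l) l0.
by move=> /(_ isT le); lia.
Qed.

Import Order.TTheory GRing.Theory Num.Theory.
Local Open Scope ring_scope.

(** * The limit region *)

Section Analysis.
Variable R : realFieldType.
Implicit Types (a g x y u v m : R).

Inductive lex_region a g : R -> R -> Prop :=
| LexNone : lex_region a g 0 0
| LexAll : lex_region a g 1 1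
| LexWithout y v : lex_region a g y v -> lex_region a g (a * y) (g * v)
| LexWith y v : lex_region a g y v ->
    lex_region a g (a + (1 - a) * y) (g + (1 - g) * v).

Lemma lex_region_itv a g y v : 0 < a -> a <= g -> g < 1 -> lex_region a g y v ->
  [/\ 0 <= y, y <= 1, y <= v & v <= 1].
Proof.
move=> a0 ag g1; elim=> [||{}y {}v _ [y0 y1 yv v1]|{}y {}v _ [y0 y1 yv v1]].
- by split; lra.
- by split; lra.
- by split; nra.
- by split; nra.
Qed.

Lemma lex_region_bilinear a g m G0 V W Z y v :
  0 < a -> a < g -> g < 1 -> 0 <= V -> 0 <= Z ->
  a * (1 - g) * Z <= (g - a) * V -> m <= G0 -> m <= G0 + V - W + Z ->
  lex_region a g y v -> m <= G0 + V * v - W * y + Z * y * v.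
Proof.
move=> a0 ag g1 V0 Z0 crit m0 m1 reg.
have mid G0' V' W' Z' : a * (1 - g) * Z' <= (g - a) * V' -> m <= G0' ->
    m <= G0' + V' - W' + Z' -> m <= G0' + g * V' - a * W' + a * g * Z'.
  move=> crit' m0' m1'.
  have : (1 - a) * m <= (1 - a) * G0' by rewrite ler_wpM2l //; lra.
  have : a * m <= a * (G0' + V' - W' + Z') by rewrite ler_wpM2l //; lra.
  lra.
elim: reg G0 V W Z V0 Z0 crit m0 m1 => [||{}y {}v _ IH|{}y {}v _ IH] G0 V W Z V0 Z0 crit m0 m1.
- lra.
- lra.
- have {}mid := mid _ _ _ _ crit m0 m1.
  suff : m <= G0 + (g * V) * v - (a * W) * y + (a * g * Z) * y * v by lra.
  apply: IH => //; try lra; try by rewrite !mulr_ge0 //; lra.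
  have : a * (1 - g) * Z * g <= (g - a) * V * g by rewrite ler_wpM2r //; lra.
  have : a * (1 - g) * Z * g * a <= a * (1 - g) * Z * g * 1.
    by rewrite ler_wpM2l ?mulr_ge0 //; lra.
  lra.
- have {}mid := mid _ _ _ _ crit m0 m1.
  suff : m <= (G0 + g * V - a * W + a * g * Z) + ((1 - g) * (V + a * Z)) * v
     - ((1 - a) * (W - g * Z)) * y + ((1 - a) * (1 - g) * Z) * y * v by lra.
  apply: IH => //; try lra.
  + by apply: mulr_ge0; [lra | rewrite addr_ge0 // mulr_ge0 //; lra].
  + by rewrite !mulr_ge0 //; lra.
  + have : a * (1 - g) * Z * (1 - g) <= (g - a) * V * (1 - g) by rewrite ler_wpM2r //; lra.
    have : 0 <= (g - a) * (1 - g) * (a * Z) by rewrite !mulr_ge0 //; lra.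
    have : 0 <= a * (1 - g) * Z * (1 - g) * a by rewrite !mulr_ge0 //; lra.
    lra.
Qed.

(* With X = a ^ j and Y = g ^ j, this is the part of the region between (a * X, g * Y) and
   (X, Y); the form is u - (1 - a) / a * x * (1 - u) there, and d stands for (1 - a) ^ 2 / a. *)
Lemma node_bound a g d X Y :
  0 < a -> a < g -> g < 2^-1 -> 0 < X -> 0 < Y -> Y <= 1 ->
  a * d = (1 - a) ^+ 2 ->
  (1 - a) * X * (1 - g * Y) < g * Y -> (1 - a) * X * (1 - Y) < a * Y ->
  (a * (1 - a) * (1 - g) * X < g - a ->
   (1 - a) ^+ 2 * X * (1 - g * (2 - a)) <= (g - a) * (1 + (1 - a) * X)) ->
  exists2 m, 0 < m & forall y v, lex_region a g y v ->
    m <= (g * Y - (1 - a) * X * (1 - g * Y)) + (1 - g) * Y * (1 + (1 - a) * X) * v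
         - d * X * (1 - g * Y) * y + d * (1 - g) * X * Y * y * v.
Proof.
move=> a0 ag g2 X0 Y0 Y1 dE hG0 hG1 hR.
have d0 : 0 < d.
  by rewrite -(pmulr_rgt0 _ a0) dE exprn_gt0 //; lra.
have [w wE] : exists w, w = (1 - a) * X * (1 - g * Y) by exists ((1 - a) * X * (1 - g * Y)).
rewrite -wE in hG0 *.
have gY : 0 < 1 - g * Y.
  by have : g * Y <= g * 1 by [rewrite ler_wpM2l //; lra]; lra.
have w0 : 0 < w by rewrite wE !mulr_gt0 //; lra.
have [s sE] : exists s, s = 1 + (1 - a) * X by exists (1 + (1 - a) * X).
rewrite -sE in hR *.
have s1 : 1 < s by rewrite sE ltrDl mulr_gt0 //; lra.
have [V VE] : exists V, V = (1 - g) * Y * s by exists ((1 - g) * Y * s).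
have [W WE] : exists W, W = d * X * (1 - g * Y) by exists (d * X * (1 - g * Y)).
have [Z ZE] : exists Z, Z = d * (1 - g) * X * Y by exists (d * (1 - g) * X * Y).
rewrite -VE -WE -ZE.
have V0 : 0 < V by rewrite VE !mulr_gt0 //; lra.
have Z0 : 0 < Z by rewrite ZE !mulr_gt0 //; lra.
have aW : a * W = (1 - a) * w by rewrite WE wE; ring: dE.
have aZ : a * Z = (1 - a) ^+ 2 * (1 - g) * X * Y by rewrite ZE; ring: dE.
have G1 : 0 < g * Y - w + V - W + Z.
  rewrite -(pmulr_rgt0 _ a0).
  have -> : a * (g * Y - w + V - W + Z) = a * Y - (1 - a) * X * (1 - Y).
    by rewrite WE VE ZE sE wE; ring: dE.
  lra.
have g1 : g < 1 by lra.
have [a0' g0' a1' g1'] : [/\ 0 <= a, 0 <= g, 0 <= 1 - a & 0 <= 1 - g] by split; lra.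
have [V0' Z0'] : 0 <= V /\ 0 <= Z by split; apply: ltW.
have [crit|crit] := lerP (a * (1 - g) * Z) ((g - a) * V).
  exists (Num.min (g * Y - w) (g * Y - w + V - W + Z)).
    by rewrite lt_min G1 andbT; lra.
  move=> y v reg; apply: (lex_region_bilinear a0 ag) => //; try exact: ltW.
  - by rewrite ge_min lexx.
  - by rewrite ge_min lexx orbT.
have [VW|VW] := lerP W V.
  exists (g * Y - w); first by lra.
  move=> y v /(lex_region_itv a0 (ltW ag) g1) [y0 y1 yv v1].
  have : 0 <= V * (v - y) by rewrite mulr_ge0 ?subr_ge0.
  have : 0 <= (V - W) * y by rewrite mulr_ge0 ?subr_ge0.
  have v0 := le_trans y0 yv.
  have : 0 <= Z * y * v by rewrite !mulr_ge0.
  clear; lra.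
have low : a * (1 - a) * (1 - g) * X < g - a.
  have : a * V < (1 - a) * (g * Y).
    apply: (@lt_trans _ _ (a * W)); first by rewrite ltr_pM2l.
    by rewrite aW ltr_pM2l //; lra.
  have -> : a * V = a * (1 - g) * s * Y by rewrite VE; ring.
  rewrite mulrA ltr_pM2r // sE => H; lra.
have {}hR := hR low.
have crit' : (g - a) * s < (1 - g) * (1 - a) ^+ 2 * X.
  rewrite -(ltr_pM2r (_ : 0 < (1 - g) * Y)); last by rewrite mulr_gt0 //; lra.
  have -> : (g - a) * s * ((1 - g) * Y) = (g - a) * V by rewrite VE; ring.
  apply: (lt_le_trans crit); rewrite -mulrA mulrCA aZ; lra.
have [Gm GmE] : exists Gm, Gm = g * Y - w + g * V - a * W + a * g * Z.
  by exists (g * Y - w + g * V - a * W + a * g * Z).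
have Gm0 : 0 < Gm.
  have -> : Gm = (2 - g) * (g * Y - w) +
     (1 - a) * X * ((2 - a) * g * (1 - g) * Y - (g - a) * (1 - g * Y)).
    by rewrite GmE -[a * g * Z]mulrAC aZ aW VE sE wE; ring.
  apply: addr_gt0; first by rewrite mulr_gt0 //; lra.
  rewrite !mulr_gt0 //; first by lra.
  rewrite subr_gt0 -(ltr_pM2r (_ : 0 < s)); last by lra.
  apply: (@lt_trans _ _ ((1 - g) * (1 - a) ^+ 2 * X * (1 - g * Y))).
    by rewrite mulrAC ltr_pM2r.
  have -> : (1 - g) * (1 - a) ^+ 2 * X * (1 - g * Y) = (1 - g) * (1 - a) * w.
    by rewrite wE; ring.
  apply: (@lt_trans _ _ ((1 - g) * (1 - a) * (g * Y))).
    by rewrite ltr_pM2l // mulr_gt0 //; lra.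
  have q0 : 0 < (1 - g) * (g * Y) by rewrite !mulr_gt0 //; lra.
  have : (1 - a) * ((1 - g) * (g * Y)) < (2 - a) * ((1 - g) * (g * Y)) by rewrite ltr_pM2r //; lra.
  have : (2 - a) * ((1 - g) * (g * Y)) * 1 < (2 - a) * ((1 - g) * (g * Y)) * s.
    by rewrite ltr_pM2l // mulr_gt0 //; lra.
  lra.
exists (Num.min Gm (Num.min (g * Y - w) (g * Y - w + V - W + Z))).
  by rewrite !lt_min G1 Gm0 !andbT subr_gt0.
set m := Num.min _ _.
have mm : m <= Gm by rewrite ge_min lexx.
have mG0 : m <= g * Y - w by rewrite !ge_min lexx orbT.
have mG1 : m <= g * Y - w + V - W + Z by rewrite !ge_min lexx !orbT.
have hR' : 0 <= (g - a) * s - (1 - a) ^+ 2 * X * (1 - g * (2 - a)) by rewrite subr_ge0.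
have g2' : 0 <= 1 - 2 * g by lra.
have [X0' Y0'] : 0 <= X /\ 0 <= Y by split; apply: ltW.
have critR : a * (1 - g) * ((1 - a) * (1 - g) * Z) <= (g - a) * ((1 - g) * (V + a * Z)).
  have -> : a * (1 - g) * ((1 - a) * (1 - g) * Z) = (1 - g) ^+ 2 * (1 - a) * (a * Z) by ring.
  rewrite aZ VE.
  have : 0 <= (1 - g) ^+ 2 * Y * ((g - a) * s - (1 - a) ^+ 2 * X * (1 - g * (2 - a))).
    by rewrite !mulr_ge0 ?exprn_ge0.
  clear; lra.
have critL : a * (1 - g) * (a * g * Z) <= (g - a) * (g * V).
  have -> : a * (1 - g) * (a * g * Z) = (1 - g) * a * g * (a * Z) by ring.
  rewrite aZ VE.
  have : 0 <= (1 - g) * g * Y * ((g - a) * s - (1 - a) ^+ 2 * X * (1 - g * (2 - a))).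
    by rewrite !mulr_ge0.
  have : 0 <= (1 - g) * g * Y * ((1 - a) ^+ 2 * X * ((1 - a) * (1 - 2 * g))).
    by rewrite !mulr_ge0 ?exprn_ge0.
  clear; lra.
have [gV agZ rV rZ] : [/\ 0 <= g * V, 0 <= a * g * Z, 0 <= (1 - g) * (V + a * Z)
                        & 0 <= (1 - a) * (1 - g) * Z].
  by split; rewrite ?mulr_ge0 // addr_ge0 // mulr_ge0.
clear crit crit' hR hR' hG0 hG1 low VW aW aZ VE WE ZE sE wE.
clearbody m.
move=> y v reg; case: {y v} reg => [||y v reg|y v reg].
- by rewrite !mulr0 addr0 subr0 addr0.
- by rewrite !mulr1.
- have -> : g * Y - w + V * (g * v) - W * (a * y) + Z * (a * y) * (g * v) =
    (g * Y - w) + (g * V) * v - (a * W) * y + (a * g * Z) * y * v by ring.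
  by apply: (lex_region_bilinear a0 ag); rewrite -?GmE.
- have -> : g * Y - w + V * (g + (1 - g) * v) - W * (a + (1 - a) * y) +
      Z * (a + (1 - a) * y) * (g + (1 - g) * v) =
    Gm + ((1 - g) * (V + a * Z)) * v
     - ((1 - a) * (W - g * Z)) * y + ((1 - a) * (1 - g) * Z) * y * v by rewrite GmE; ring.
  apply: (lex_region_bilinear a0 ag) => //.
  have -> // : Gm + (1 - g) * (V + a * Z) - (1 - a) * (W - g * Z) + (1 - a) * (1 - g) * Z =
    g * Y - w + V - W + Z by rewrite GmE; ring.
Qed.

(* This lemma and the next verify the last hypothesis of [node_bound], for j = 0 and j > 0. *)
Lemma right_criterion0 a g : 0 < a -> a < g -> g < 2^-1 -> 1 - a < g * (2 - a) ->
  a * (1 - a) * (1 - g) < g - a ->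
  (1 - a) ^+ 2 * (1 - g * (2 - a)) <= (g - a) * (1 + (1 - a)).
Proof.
move=> a0 ag g2 c0 low.
apply: (@le_trans _ _ ((1 - a) ^+ 2 * a)).
  by rewrite ler_wpM2l ?exprn_ge0 //; lra.
apply: (@le_trans _ _ (a * (1 - a) * (1 - g) * (2 - a))); last first.
  have -> : 1 + (1 - a) = 2 - a by ring.
  by rewrite ler_wpM2r //; lra.
have : 0 <= a * (1 - a) * ((1 - g) * (2 - a) - (1 - a)).
  rewrite !mulr_ge0 //; try lra.
  have : 0 <= (1 - 2 * g) * (2 - a) by rewrite mulr_ge0 //; lra.
  lra.
lra.
Qed.

Lemma right_criterion1 a g X : 0 < a -> a < g -> g < 2^-1 -> 0 < X -> X <= a ->
  1 - a < g * (2 - a) -> a - a ^+ 2 <= g ^+ 2 * (1 + a - a ^+ 2) ->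
  a * (1 - a) * (1 - g) * X < g - a ->
  (1 - a) ^+ 2 * X * (1 - g * (2 - a)) <= (g - a) * (1 + (1 - a) * X).
Proof.
move=> a0 ag g2 X0 Xa c0 c1 low.
have ga : 0 < g - a by lra.
have pos : 0 <= (g - a) * ((1 - a) * X) by rewrite !mulr_ge0 //; lra.
have [far|near] := lerP ((1 - 2 * a) * (1 - 2 * g)) (a ^+ 2 * g).
  have : 0 <= (1 - a) * X * (a ^+ 2 * g - (1 - 2 * a) * (1 - 2 * g)).
    by rewrite !mulr_ge0 //; lra.
  lra.
have q0 : 0 < 1 + a - a ^+ 2.
  have : 0 <= a * (1 - a) by rewrite mulr_ge0 //; lra.
  lra.
have a_lt : a < 5%:R / 13%:R.
  have h : 0 < 2 - 4 * a + a ^+ 2 by have := exprn_gt0 2 a0; lra.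
  have : (1 - a) * (2 - 4 * a + a ^+ 2) < g * (2 - a) * (2 - 4 * a + a ^+ 2).
    by rewrite ltr_pM2r.
  have : (2 - a) * (a ^+ 2 * g) < (2 - a) * ((1 - 2 * a) * (1 - 2 * g)).
    by rewrite ltr_pM2l //; lra.
  move=> h1 h2; have : 0 < a * (1 - 3 * a + a ^+ 2) by lra.
  rewrite pmulr_rgt0 // => h3; rewrite ltNge; apply/negP => h4.
  have : 0 <= (a - 5%:R / 13%:R) * (2^-1 - a) by rewrite mulr_ge0 //; lra.
  lra.
have g_ge : a ^+ 2 * (1 - a) ^+ 2 <= (g - a) * (1 + a - a ^+ 2).
  rewrite leNgt; apply/negP => lt.
  set q := 1 + a - a ^+ 2 in q0 lt c1.
  have e : a * q + a ^+ 2 * (1 - a) ^+ 2 = a * (q + a * (1 - a) ^+ 2) by ring.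
  have lt' : g * q < a * (q + a * (1 - a) ^+ 2) by lra.
  have q1 : q <= 209%:R / 169%:R.
    have : 0 <= (5%:R / 13%:R - a) * (1 - a - 5%:R / 13%:R) by rewrite mulr_ge0 //; lra.
    rewrite /q; lra.
  have q2 : a * (1 - a) ^+ 2 <= 4 / 27%:R.
    have : 0 <= (a - 3^-1) ^+ 2 * (4 / 3 - a) by rewrite mulr_ge0 ?sqr_ge0 //; lra.
    lra.
  have lt2 : g * q < a * (1386%:R / 1000%:R).
    by apply: lt_le_trans lt' _; rewrite ler_pM2l //; lra.
  have lt3 : (g * q) ^+ 2 < (a * (1386%:R / 1000%:R)) ^+ 2.
    have gq : 0 < g * q by rewrite mulr_gt0 //; lra.
    by rewrite ltr_pXn2r // nnegrE; [apply: ltW | clear -a0; lra].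
  have : (a - a ^+ 2) * q <= g ^+ 2 * q * q by rewrite ler_pM2r.
  have -> : g ^+ 2 * q * q = (g * q) ^+ 2 by ring.
  move=> le4; have {le4 lt3} : a * ((1 - a) * q) < a * (a * (1386%:R / 1000%:R) ^+ 2) by lra.
  rewrite ltr_pM2l // /q.
  have -> : (1 - a) * (1 + a - a ^+ 2) = 1 - 2 * a ^+ 2 + a ^+ 3 by ring.
  have a30 : 0 < a ^+ 3 by rewrite exprn_gt0.
  clear lt lt' lt2 q1 q2 c0 c1 low near pos q0 e.
  have : 0 <= (5%:R / 13%:R - a) * a by rewrite mulr_ge0 //; lra.
  have : 0 <= (5%:R / 13%:R - a) ^+ 2 * a by rewrite mulr_ge0 ?sqr_ge0 //; lra.
  rewrite [(_ - a) ^+ 2]sqrrB; lra.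
have : (1 - a) ^+ 2 * X * a * (1 - g * (2 - a)) <= (1 - a) ^+ 2 * X * a * a.
  by rewrite ler_wpM2l ?mulr_ge0 ?exprn_ge0 //; lra.
have : 0 <= (g - a) * (a - X) by rewrite mulr_ge0 //; lra.
have : a ^+ 2 * (1 - a) ^+ 2 * X <= (g - a) * (1 + a - a ^+ 2) * X.
  by rewrite ler_wpM2r //; lra.
clear low c0 c1 near pos g_ge; move=> h1 h2 h3; rewrite -(ler_pM2r a0); lra.
Qed.

End Analysis.

Section Gap.
Variable R : realFieldType.
Implicit Types (a g x y u v m e : R).

Lemma lex_region_decomp a g J x u : lex_region a g x u ->
  (exists y v, [/\ lex_region a g y v, x = a ^+ J * y & u = g ^+ J * v]) \/
  (exists j y v, [/\ (j < J)%N, lex_region a g y v,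
     x = a ^+ j * (a + (1 - a) * y) & u = g ^+ j * (g + (1 - g) * v)]).
Proof.
move=> reg; elim: J => [|J [[y [v [reg' -> ->]]]|[j [y [v [jJ reg' -> ->]]]]]].
- by left; exists x, u; rewrite !expr0 !mul1r.
- case: {y v} reg' => [||y v reg'|y v reg'].
  + by left; exists 0, 0; rewrite !mulr0; split=> //; apply: LexNone.
  + right; exists J, 1, 1; split=> //; first exact: LexAll.
      by rewrite !mulr1 [a + _]addrC subrK mulr1.
    by rewrite !mulr1 [g + _]addrC subrK mulr1.
  + by left; exists y, v; rewrite !exprSr -!mulrA.
  + by right; exists J, y, v.
- by right; exists j, y, v; split=> //; apply: ltnW.
Qed.

Lemma lex_region_gap a g : 0 < a -> a < g -> g < 2^-1 ->
  (forall j, (1 - a) * a ^+ j * (1 - g ^+ j.+1) < g ^+ j.+1) ->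
  forall J, exists2 m, 0 < m & forall x u, lex_region a g x u -> a ^+ J < x ->
    (1 + (1 - a) / a * x) * (1 - u) <= 1 - m.
Proof.
move=> a0 ag g2 cond J.
have g1 : g < 1 by lra.
have g0 : 0 < g by lra.
have c0 : 1 - a < g * (2 - a) by have := cond 0%N; rewrite expr0 expr1; lra.
have c1 : a - a ^+ 2 <= g ^+ 2 * (1 + a - a ^+ 2).
  by have := cond 1%N; rewrite expr1; lra.
have [m m0 mP] : exists2 m, 0 < m & forall j y v, (j < J)%N -> lex_region a g y v ->
    (1 + (1 - a) / a * (a ^+ j * (a + (1 - a) * y))) * (1 - g ^+ j * (g + (1 - g) * v))
      <= 1 - m.
  elim: J => [|J [m m0 mP]]; first by exists 1.
  have Y1 : g ^+ J <= 1 by rewrite exprn_ile1 ?ltW.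
  have dE : a * ((1 - a) ^+ 2 / a) = (1 - a) ^+ 2 by rewrite mulrC divfK ?gt_eqF.
  have hG0 : (1 - a) * a ^+ J * (1 - g * g ^+ J) < g * g ^+ J by rewrite -exprS.
  have hG1 : (1 - a) * a ^+ J * (1 - g ^+ J) < a * g ^+ J.
    case: (J) => [|J']; first by rewrite !expr0 subrr mulr0 mulr1.
    rewrite exprS mulrCA -!mulrA (mulrA _ (a ^+ J')) mulrA.
    by rewrite -!mulrA ltr_pM2l // mulrA.
  have hR : a * (1 - a) * (1 - g) * a ^+ J < g - a ->
      (1 - a) ^+ 2 * a ^+ J * (1 - g * (2 - a)) <= (g - a) * (1 + (1 - a) * a ^+ J).
    case: (J) => [|J'].
      by rewrite expr0 !mulr1; apply: right_criterion0.
    apply: right_criterion1 => //; first by rewrite exprn_gt0.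
    by rewrite exprS ger_pMr // exprn_ile1 // ltW //; lra.
  have [m' m'0 m'P] := node_bound a0 ag g2 (exprn_gt0 J a0) (exprn_gt0 J g0) Y1 dE hG0 hG1 hR.
  exists (Num.min m m'); first by rewrite lt_min m0.
  move=> j y v; rewrite ltnS leq_eqVlt => /orP[/eqP ->|jJ] reg; last first.
    by apply: le_trans (mP _ _ _ jJ reg) _; rewrite lerD2l lerN2 ge_min lexx.
  have := m'P y v reg.
  have : Num.min m m' <= m' by rewrite ge_min lexx orbT.
  move: (Num.min m m') => mm le1 le2; have := le_trans le1 le2.
  rewrite -subr_ge0 => h; rewrite -subr_ge0; apply: le_trans h _.
  by rewrite le_eqVlt; apply/orP; left; apply/eqP; field; rewrite gt_eqF.
exists m => // x u reg; case: (lex_region_decomp J reg) => [[y [v [reg' -> _]]]|].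
  have [y0 y1 _ _] := lex_region_itv a0 (ltW ag) g1 reg'.
  by rewrite ltr_pMr ?exprn_gt0 // ltNge y1.
by case=> j [y [v [jJ reg' -> ->]]] _; apply: mP.
Qed.

Lemma lex_region_gap_half a g : 2^-1 < a -> a < g -> g < 1 ->
  forall J, exists2 m, 0 < m & forall x u, lex_region a g x u -> a ^+ J < x ->
    (1 + (1 - a) / a * x) * (1 - u) <= 1 - m.
Proof.
move=> a2 ag g1 J; have a0 : 0 < a by lra.
set c := (1 - a) / a.
have c0 : 0 < c by rewrite divr_gt0 //; lra.
have c1 : c < 1 by rewrite /c ltr_pdivrMr //; lra.
have aJ : 0 < a ^+ J by rewrite exprn_gt0.
exists ((1 - c) * a ^+ J); first by rewrite mulr_gt0 ?subr_gt0.
move=> x u reg xJ; have [x0 x1 xu u1] := lex_region_itv a0 (ltW ag) g1 reg.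
apply: (@le_trans _ _ ((1 + c * x) * (1 - x))).
  by rewrite ler_wpM2l ?lerD2l ?lerN2 // addr_ge0 // mulr_ge0 // ltW.
have := mulr_ge0 (mulr_ge0 (ltW c0) x0) x0.
have : (1 - c) * a ^+ J <= (1 - c) * x by rewrite ler_wpM2l ?subr_ge0 // ltW.
clear; lra.
Qed.
End Gap.

From mathcomp Require Import classical_sets functions filter topology normedtype sequences.
Import numFieldNormedType.Exports.

(** * Asymptotics of cascades *)

Section Limits.
Local Open Scope classical_set_scope.
Variable R : realType.
Implicit Types (N r : nat -> nat) (a g rho x : R) (w : seq bool).

Fixpoint word_point a w : R :=
  if w is b :: w' then
    if b then a + (1 - a) * word_point a w' else a * word_point a w'
  else 0.

Fixpoint word_measure a w : R :=
  if w is b :: w' then (if b then 1 - a else a) * word_measure a w' else 1.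

Lemma lex_region_word a g w : lex_region a g (word_point a w) (word_point g w).
Proof.
by elim: w => [|[] w IHw] /=; [apply: LexNone | apply: LexWith | apply: LexWithout].
Qed.

Lemma word_measure_bound a w : 0 < a < 1 ->
  0 < word_measure a w <= Num.max a (1 - a) ^+ size w.
Proof.
move=> /andP[a0 a1]; elim: w => [|b w /andP[IH0 IH]] /=; first by rewrite ltr01 lexx.
set p := if b then _ else _.
have p0 : 0 < p by rewrite /p; case: (b); lra.
have pm : p <= Num.max a (1 - a) by rewrite /p le_max; case: (b); rewrite lexx ?orbT.
by rewrite mulr_gt0 //= exprS ler_pM // ltW.
Qed.

Definition asymp N r rho : Prop :=
  (fun n => (r n)%:R / (N n)%:R : R) @ \oo --> rho /\
  (fun n => (N n)%:R^-1 : R) @ \oo --> (0 : R).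

Lemma cvg_near_eq (u v : nat -> R) (l : R) :
  (\forall n \near \oo, u n = v n) -> u @ \oo --> l -> v @ \oo --> l.
Proof. by move=> /near_eq_cvg uv; apply: cvg_trans. Qed.

Lemma asymp_room N r rho K : 0 < rho < 1 -> asymp N r rho ->
  \forall n \near \oo, (K <= r n)%N /\ (r n + K <= N n)%N.
Proof.
move=> /andP[rho0 rho1] [cr cN].
have e1 : 0 < rho / 2 by rewrite divr_gt0.
have e2 : rho < (1 + rho) / 2 by lra.
have e3 : 0 < Num.min (rho / 2) ((1 - rho) / 2) / K.+1%:R.
  by rewrite divr_gt0 ?ltr0n // lt_min e1 /=; lra.
have e4 : rho / 2 < rho by lra.
have h1 := cvgr_gt _ cr _ e4.
have h2 := cvgr_lt _ cr _ e2.
have h3 := cvgr_lt _ cN _ e3.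
near=> n.
have r1 : rho / 2 < (r n)%:R / (N n)%:R by near: n; apply: h1.
have r2 : (r n)%:R / (N n)%:R < (1 + rho) / 2 by near: n; apply: h2.
have r3 : (N n)%:R^-1 < Num.min (rho / 2) ((1 - rho) / 2) / K.+1%:R by near: n; apply: h3.
have N0 : 0 < (N n)%:R :> R.
  rewrite lt0r ler0n andbT; apply/eqP => N0; move: r1; rewrite N0 invr0 mulr0; lra.
have K0 : 0 < K.+1%:R :> R by rewrite ltr0n.
move: r3; rewrite ltr_pdivlMr // lt_min => /andP[r3 r4].
move: r1; rewrite ltr_pdivlMr // => r1.
move: r2; rewrite ltr_pdivrMr // => r2.
have KN : K.+1%:R = (N n)%:R^-1 * K.+1%:R * (N n)%:R :> R.
  by rewrite mulrAC mulVf ?mul1r // gt_eqF.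
have KN1 : K.+1%:R < (r n)%:R :> R.
  by rewrite KN (lt_trans _ r1) // ltr_pM2r.
have KN2 : (r n)%:R + K.+1%:R < (N n)%:R :> R.
  have : K.+1%:R < (1 - rho) / 2 * (N n)%:R :> R by rewrite KN ltr_pM2r.
  lra.
rewrite -natrD !ltr_nat in KN1 KN2.
by clear -KN1 KN2; split; lia.
Unshelve. all: by end_near.
Qed.

Lemma natr_pred m : (0 < m)%N -> m.-1%:R = m%:R - 1 :> R.
Proof. by case: m => // m _; rewrite -[in RHS]natr1 addrK. Qed.

Lemma asymp_pred N r rho b : 0 < rho < 1 -> asymp N r rho ->
  asymp (fun n => (N n).-1) (fun n => if b then (r n).-1 else r n) rho.
Proof.
move=> rho01 asy; have [cr cN] := asy.
have room := asymp_room 2 rho01 asy.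
split.
  have : (fun n => ((r n)%:R / (N n)%:R - (b : nat)%:R * (N n)%:R^-1) / (1 - (N n)%:R^-1) : R)
      @ \oo --> (rho - (b : nat)%:R * 0) / (1 - 0).
    apply: cvgM; first by apply: cvgB => //; apply: cvgM => //; apply: cvg_cst.
    by apply: cvgV; [rewrite subr0 oner_neq0 | apply: cvgB => //; apply: cvg_cst].
  rewrite mulr0 !subr0 divr1; apply: cvg_trans; apply: near_eq_cvg.
  near=> n; have [r2 rN] : (2 <= r n)%N /\ (r n + 2 <= N n)%N by near: n.
  have -> : (if b then (r n).-1 else r n)%:R = (r n)%:R - (b : nat)%:R :> R.
    by case: (b); rewrite ?subr0 // natr_pred // ltnW.
  rewrite natr_pred; last by lia.
  have N1 : 1 < (N n)%:R :> R by rewrite ltr1n; lia.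
  by clear -N1; field; rewrite !gt_eqF //; lra.
have : (fun n => (N n)%:R^-1 / (1 - (N n)%:R^-1) : R) @ \oo --> (0 / (1 - 0) : R).
  apply: cvgM => //; apply: cvgV; first by rewrite subr0 oner_neq0.
  by apply: cvgB => //; apply: cvg_cst.
rewrite mul0r; apply: cvg_trans; apply: near_eq_cvg.
near=> n; have [r2 rN] : (2 <= r n)%N /\ (r n + 2 <= N n)%N by near: n.
rewrite natr_pred; last by lia.
have N1 : 1 < (N n)%:R :> R by rewrite ltr1n; lia.
by clear -N1; field; rewrite !gt_eqF //; lra.
Unshelve. all: by end_near.
Qed.

Lemma bin_ratio (N r : nat) : (0 < r)%N -> (r <= N)%N ->
  ('C(N.-1, r)%:R / 'C(N, r)%:R = 1 - r%:R / N%:R :> R) /\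
  ('C(N.-1, r.-1)%:R / 'C(N, r)%:R = r%:R / N%:R :> R).
Proof.
move=> r0 rN; have C0 : 'C(N, r)%:R != 0 :> R by rewrite pnatr_eq0 -lt0n bin_gt0.
have N0 : N%:R != 0 :> R by rewrite pnatr_eq0; lia.
split.
  have := congr1 (fun m => m%:R : R) (mul_bin_down N r); rewrite !natrM natrB // => e.
  apply: (mulfI N0); rewrite mulrA e mulrBr mulr1 mulrCA divff // mulr1.
  by rewrite mulfK.
have := congr1 (fun m => m%:R : R) (mul_bin_diag N r.-1); rewrite prednK // !natrM => e.
by apply: (mulfI N0); rewrite mulrA e mulfK // mulrCA divff // mulr1.
Qed.

Lemma cvg_word rho w N r : 0 < rho < 1 -> asymp N r rho ->
  (fun n => (word_low (N n) (r n) w)%:R / 'C(N n, r n)%:R : R) @ \oo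
     --> word_point (1 - rho) w /\
  (fun n => (word_width (N n) (r n) w)%:R / 'C(N n, r n)%:R : R) @ \oo
     --> word_measure (1 - rho) w.
Proof.
move=> rho01; elim: w N r => [|b w IHw] N r asy /=.
  split; first by apply: cvg_near_eq (cvg_cst 0); apply: nearW => n; rewrite mul0r.
  apply: (@cvg_trans _ ((fun=> 1) @ \oo)); last exact: cvg_cst.
  apply: near_eq_cvg; have room := asymp_room 0 rho01 asy.
  near=> n; have [_ rN] : (0 <= r n)%N /\ (r n + 0 <= N n)%N by near: n.
  by rewrite divff // pnatr_eq0 -lt0n bin_gt0; lia.
have [cr cN] := asy.
have room := asymp_room 2 rho01 asy.
have [IH1 IH2] := IHw _ _ (asymp_pred b rho01 asy).
have c1 : (fun n => 1 - (r n)%:R / (N n)%:R : R) @ \oo --> 1 - rho.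
  by apply: cvgB => //; apply: cvg_cst.
have step (u : nat -> nat) l :
    (fun n => (u n)%:R / 'C((N n).-1, if b then (r n).-1 else r n)%:R : R) @ \oo --> l ->
    (fun n => (u n)%:R / 'C(N n, r n)%:R : R) @ \oo --> (if b then rho else 1 - rho) * l.
  move=> cu.
  have : (fun n => (if b then (r n)%:R / (N n)%:R else 1 - (r n)%:R / (N n)%:R) *
     ((u n)%:R / 'C((N n).-1, if b then (r n).-1 else r n)%:R) : R) @ \oo
      --> (if b then rho else 1 - rho) * l.
    by apply: cvgM => //; case: (b).
  apply: cvg_trans; apply: near_eq_cvg.
  near=> n; have [r2 rN] : (2 <= r n)%N /\ (r n + 2 <= N n)%N by near: n.
  have [||e1 e2] := @bin_ratio (N n) (r n) _ _; [lia|lia|].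
  have C0 : 'C((N n).-1, if b then (r n).-1 else r n)%:R != 0 :> R.
    by rewrite pnatr_eq0 -lt0n bin_gt0; case: (b); lia.
  have -> : (if b then (r n)%:R / (N n)%:R else 1 - (r n)%:R / (N n)%:R) =
     'C((N n).-1, if b then (r n).-1 else r n)%:R / 'C(N n, r n)%:R :> R.
    by case: (b).
  by rewrite mulrC mulrA divfK.
split; last first.
  have := step _ _ IH2; congr (_ --> _); by case: (b); rewrite ?subKr.
have := step _ _ IH1; case: b {IH1 IH2 step} => // cw.
rewrite subKr; apply: cvg_near_eq (cvgD c1 cw).
near=> n; have [r2 rN] : (2 <= r n)%N /\ (r n + 2 <= N n)%N by near: n.
have [||e _] := @bin_ratio (N n) (r n) _ _; [lia|lia|].
by rewrite natrD mulrDl e.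
Unshelve. all: by end_near.
Qed.

End Limits.

Section OneSided.
Local Open Scope classical_set_scope.
Variable R : realType.

Lemma exists_expr_lt (z e : R) : 0 <= z < 1 -> 0 < e -> exists M, z ^+ M < e.
Proof.
move=> /andP[z0 z1] e0; have := @cvg_expr R z; rewrite ger0_norm // => /(_ z1) cz.
by case: (cvgr_lt _ cz _ e0) => M _ MP; exists M; apply: MP => /=.
Qed.

Lemma bin_quotient_decay (N r l i : nat) (q : R) :
  (l <= r)%N -> (r + i <= N)%N -> 0 <= q -> q <= 1 ->
  N%:R - r%:R <= q * (N%:R - l%:R) ->
  'C(N - i, r)%:R * 'C(N, l)%:R <= q ^+ i * 'C(N, r)%:R * 'C(N - i, l)%:R :> R.
Proof.
move=> lr rN q0 q1 qN; elim: i rN => [|i IHi] rN; first by rewrite subn0 expr0 mul1r.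
have {}IHi := IHi (leq_trans (leq_add (leqnn _) (leqnSn _)) rN).
set s := (N - i)%N in IHi; have -> : (N - i.+1)%N = s.-1 by rewrite /s; lia.
have rs : (r < s)%N by rewrite /s; lia.
have sE : s%:R = N%:R - i%:R :> R by rewrite /s natrB //; lia.
have bE m : (m <= s)%N -> 'C(s.-1, m)%:R * s%:R = (s%:R - m%:R) * 'C(s, m)%:R :> R.
  by move=> ms; rewrite -natrB // -!natrM -mul_bin_down mulnC.
have s0 : 0 < s%:R :> R by rewrite ltr0n; lia.
rewrite -(ler_pM2r s0).
have -> : 'C(s.-1, r)%:R * 'C(N, l)%:R * s%:R =
   (s%:R - r%:R) * ('C(s, r)%:R * 'C(N, l)%:R) :> R.
  by rewrite mulrAC bE ?mulrA // ltnW.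
have -> : q ^+ i.+1 * 'C(N, r)%:R * 'C(s.-1, l)%:R * s%:R =
   (q * (s%:R - l%:R)) * (q ^+ i * 'C(N, r)%:R * 'C(s, l)%:R) :> R.
  by rewrite -[LHS]mulrA bE ?exprS; [ring | lia].
apply: ler_pM => //; rewrite ?mulr_ge0 ?ler0n // ?subr_ge0 ?ler_nat; first exact: ltnW.
rewrite sE.
have : q * i%:R <= 1 * i%:R by rewrite ler_wpM2r.
clear -qN; lra.
Qed.

Lemma small_excess (N r l t M : nat) (q : R) :
  (l < r)%N -> (r <= t)%N -> (t + M < N)%N -> 0 <= q -> q <= 1 ->
  N%:R - r%:R <= q * (N%:R - l%:R) ->
  q ^+ M * (r%:R + 1) * N%:R <= (N%:R - r%:R) * (r%:R - l%:R) ->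
  ('C(t.+1, r) * 'C(N, l) <= 'C(N, r.+1) * 'C(t, l))%N.
Proof.
move=> lr rt tN q0 q1 qN qM.
have dec : 'C(t.+1, r)%:R * 'C(N, l)%:R <=
    q ^+ (N - t.+1) * 'C(N, r)%:R * 'C(t.+1, l)%:R :> R.
  have := @bin_quotient_decay N r l (N - t.+1) q.
  have -> : (N - (N - t.+1))%N = t.+1 by lia.
  by apply => //; lia.
rewrite -(ler_nat R) !natrM.
have Nr0 : 0 < N%:R - r%:R :> R by rewrite subr_gt0 ltr_nat; lia.
have t0 : 0 < t.+1%:R :> R by rewrite ltr0n.
rewrite -(ler_pM2r (mulr_gt0 Nr0 t0)).
apply: le_trans (ler_wpM2r (ltW (mulr_gt0 Nr0 t0)) dec) _.
have bN : (N%:R - r%:R) * 'C(N, r)%:R = (r%:R + 1) * 'C(N, r.+1)%:R :> R.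
  by rewrite natr1 -natrB; [rewrite -!natrM mul_bin_left | lia].
have bt : t.+1%:R * 'C(t, l)%:R = (t.+1%:R - l%:R) * 'C(t.+1, l)%:R :> R.
  by rewrite -natrB; [rewrite -!natrM -mul_bin_down | lia].
have -> : q ^+ (N - t.+1) * 'C(N, r)%:R * 'C(t.+1, l)%:R * ((N%:R - r%:R) * t.+1%:R) =
  (q ^+ (N - t.+1) * (r%:R + 1) * t.+1%:R) * ('C(N, r.+1)%:R * 'C(t.+1, l)%:R) :> R.
  transitivity (q ^+ (N - t.+1) * t.+1%:R * 'C(t.+1, l)%:R * ((N%:R - r%:R) * 'C(N, r)%:R)).
    by ring.
  by rewrite bN; ring.
have -> : 'C(N, r.+1)%:R * 'C(t, l)%:R * ((N%:R - r%:R) * t.+1%:R) =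
  ((N%:R - r%:R) * (t.+1%:R - l%:R)) * ('C(N, r.+1)%:R * 'C(t.+1, l)%:R) :> R.
  transitivity ((N%:R - r%:R) * 'C(N, r.+1)%:R * (t.+1%:R * 'C(t, l)%:R) : R); first by ring.
  by rewrite bt; ring.
apply: ler_wpM2r; first by rewrite mulr_ge0 ?ler0n.
apply: (@le_trans _ _ (q ^+ M * (r%:R + 1) * N%:R)).
  apply: ler_pM; rewrite ?mulr_ge0 ?exprn_ge0 ?addr_ge0 ?ler0n //; last first.
    by rewrite ler_nat; lia.
  apply: ler_wpM2r; first by rewrite addr_ge0.
  by apply: ler_wiXn2l => //; lia.
apply: le_trans qM _; apply: ler_wpM2l; first exact: ltW.
by rewrite lerD2r ler_nat; lia.
Qed.

Lemma bracket (f : nat -> nat) lo hi x : (lo <= hi)%N -> (f lo <= x < f hi)%N ->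
  exists t, [/\ (lo <= t)%N, (t < hi)%N & (f t <= x < f t.+1)%N].
Proof.
elim: hi => [|hi IHhi] le /andP[flo fhi].
  by move: le fhi; rewrite leqn0 => /eqP <-; lia.
have [lt|ge] := ltnP x (f hi).
  have le' : (lo <= hi)%N.
    move: le; rewrite leq_eqVlt => /orP[/eqP e|//]; move: flo; rewrite e; lia.
  have [|t [t1 t2 t3]] := IHhi le'; first by rewrite flo lt.
  by exists t; split=> //; apply: ltnW.
have le' : (lo <= hi)%N.
  move: le; rewrite leq_eqVlt => /orP[/eqP e|//]; move: flo; rewrite e; lia.
by exists hi; split=> //; rewrite ge fhi.
Qed.
End OneSided.

Section OneSidedBound.
Local Open Scope classical_set_scope.
Variable R : realType.
Implicit Types (a g rho : R) (N r l k : nat -> nat).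

Lemma cvg_invn : (fun n => n%:R^-1 : R) @ \oo --> (0 : R).
Proof.
apply/gtr0_cvgV0; last exact: cvgr_idn.
by near=> n; rewrite ltr0n; near: n; apply: nbhs_infty_gt.
Unshelve. all: by end_near.
Qed.

Lemma asymp_id k a : (fun n => (k n)%:R / n%:R : R) @ \oo --> a -> asymp (fun n => n) k a.
Proof. by split=> //; apply: cvg_invn. Qed.

Lemma asymp_compl N k a : 0 < a < 1 -> asymp N k a ->
  asymp N (fun n => (N n - k n)%N) (1 - a).
Proof.
move=> a01 asy; have room := asymp_room 1 a01 asy; have [ck cN] := asy.
split=> //; apply: (@cvg_near_eq R (fun n => 1 - (k n)%:R / (N n)%:R)); last first.
  by apply: cvgB => //; apply: cvg_cst.
near=> n; have [_ kn] : (1 <= k n)%N /\ (k n + 1 <= N n)%N by near: n.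
rewrite natrB; last by clear -kn; lia.
by rewrite mulrBl divff // pnatr_eq0; clear -kn; lia.
Unshelve. all: by end_near.
Qed.

Lemma cvg_bin_succ a N r : 0 < a -> a < 1 -> asymp N r (1 - a) ->
  (fun n => 'C(N n, r n)%:R / 'C(N n, (r n).+1)%:R : R) @ \oo --> (1 - a) / a.
Proof.
move=> a0 a1 asy; have [cr cN] := asy.
have rho_a : 0 < 1 - a < 1 by rewrite subr_gt0 a1 ltrBlDr ltrDl.
have room := asymp_room 2 rho_a asy.
have : (fun n => ((r n)%:R / (N n)%:R + (N n)%:R^-1) / (1 - (r n)%:R / (N n)%:R) : R) @ \oo
    --> (1 - a + 0) / (1 - (1 - a)).
  apply: cvgM; first exact: cvgD.
  apply: cvgV; first by rewrite subKr gt_eqF.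
  by apply: cvgB => //; apply: cvg_cst.
rewrite addr0 subKr; apply: cvg_near_eq.
near=> n; have [r2 rN] : (2 <= r n)%N /\ (r n + 2 <= N n)%N by near: n.
have N0 : (N n)%:R != 0 :> R by rewrite pnatr_eq0 -lt0n; lia.
have P0 : 'C(N n, (r n).+1)%:R != 0 :> R by rewrite pnatr_eq0 -lt0n bin_gt0; lia.
have Nr0 : (N n)%:R - (r n)%:R != 0 :> R.
  by rewrite -natrB ?pnatr_eq0 -?lt0n; lia.
have bN : ((N n)%:R - (r n)%:R) * 'C(N n, r n)%:R = ((r n)%:R + 1) * 'C(N n, (r n).+1)%:R :> R.
  by rewrite natr1 -natrB; [rewrite -!natrM mul_bin_left | lia].
apply: (mulIf P0); rewrite divfK //; apply: (mulfI Nr0); rewrite bN.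
by field; rewrite N0 Nr0.
Unshelve. all: by end_near.
Qed.

Lemma small_excess_ratio (N r l t M : nat) (q : R) :
  (r <= t)%N -> (t + M < N)%N -> 0 <= q -> q <= 1 -> 0 < N%:R :> R ->
  1 - r%:R / N%:R - q * (1 - l%:R / N%:R) < 0 ->
  q ^+ M * (r%:R / N%:R + N%:R^-1) - (1 - r%:R / N%:R) * (r%:R / N%:R - l%:R / N%:R) < 0 ->
  l%:R / N%:R - r%:R / N%:R < 0 :> R ->
  ('C(t.+1, r) * 'C(N, l) <= 'C(N, r.+1) * 'C(t, l))%N.
Proof.
move=> rt tN q0 q1 N0 H1 H2 H3; have N0' : N%:R != 0 :> R by rewrite gt_eqF.
have lr : (l < r)%N by move: H3; rewrite -mulrBl pmulr_llt0 ?invr_gt0 // subr_lt0 ltr_nat.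
apply: small_excess lr rt tN q0 q1 _ _; rewrite -subr_le0.
  have -> : N%:R - r%:R - q * (N%:R - l%:R) =
    (1 - r%:R / N%:R - q * (1 - l%:R / N%:R)) * N%:R by field.
  by rewrite pmulr_lle0 // ltW.
have -> : q ^+ M * (r%:R + 1) * N%:R - (N%:R - r%:R) * (r%:R - l%:R) =
  (q ^+ M * (r%:R / N%:R + N%:R^-1) -
   (1 - r%:R / N%:R) * (r%:R / N%:R - l%:R / N%:R)) * N%:R ^+ 2.
  by field.
by rewrite pmulr_lle0 ?exprn_gt0 // ltW.
Qed.

Lemma small_regime a g N r l : 0 < a -> a < g -> g < 1 ->
  asymp N r (1 - a) -> asymp N l (1 - g) ->
  exists M, \forall n \near \oo, forall t, (r n <= t)%N -> (t + M < N n)%N ->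
  ('C(t.+1, r n) * 'C(N n, l n) <= 'C(N n, (r n).+1) * 'C(t, l n))%N.
Proof.
move=> a0 ag g1 asymp_r asymp_l; have a1 := lt_trans ag g1; have g0 := lt_trans a0 ag.
have rho_a : 0 < 1 - a < 1 by rewrite subr_gt0 a1 ltrBlDr ltrDl.
have rho_g : 0 < 1 - g < 1 by rewrite subr_gt0 g1 ltrBlDr ltrDl.
pose q : R := (a / g + 1) / 2.
have ag1 : a / g < 1 by rewrite ltr_pdivrMr //; lra.
have ag0 : 0 < a / g by rewrite divr_gt0.
have q0 : 0 <= q by rewrite /q; lra.
have q1 : q < 1 by rewrite /q; lra.
have aqg : a < q * g by rewrite -ltr_pdivrMr // /q; lra.
have d0 : 0 < a * (g - a) / (1 - a) by rewrite divr_gt0 ?mulr_gt0 //; lra.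
have [M] : exists M, q ^+ M < a * (g - a) / (1 - a) by apply: exists_expr_lt => //; rewrite q0.
rewrite ltr_pdivlMr; last by lra.
move=> qM; exists M.
have [cr cN] := asymp_r; have [cl' _] := asymp_l.
have room_r := asymp_room 2 rho_a asymp_r.
have room_l := asymp_room 2 rho_g asymp_l.
have c1 : (fun n => 1 - (r n)%:R / (N n)%:R - q * (1 - (l n)%:R / (N n)%:R) : R) @ \oo
    --> 1 - (1 - a) - q * (1 - (1 - g)).
  apply: cvgB; first by apply: cvgB => //; apply: cvg_cst.
  by apply: cvgM; [apply: cvg_cst | apply: cvgB => //; apply: cvg_cst].
have c2 : (fun n => q ^+ M * ((r n)%:R / (N n)%:R + (N n)%:R^-1) -
     (1 - (r n)%:R / (N n)%:R) * ((r n)%:R / (N n)%:R - (l n)%:R / (N n)%:R) : R) @ \oo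
    --> q ^+ M * (1 - a + 0) - (1 - (1 - a)) * (1 - a - (1 - g)).
  apply: cvgB; first by apply: cvgM; [apply: cvg_cst | apply: cvgD].
  by apply: cvgM; [apply: cvgB => //; apply: cvg_cst | apply: cvgB].
have c3 : (fun n => (l n)%:R / (N n)%:R - (r n)%:R / (N n)%:R : R) @ \oo
    --> 1 - g - (1 - a) by apply: cvgB.
have h1 := cvgr_lt _ c1 0 ltac:(by lra).
have h2 := cvgr_lt _ c2 0 ltac:(by lra).
have h3 := cvgr_lt _ c3 0 ltac:(by lra).
near=> n; have [r2 rN] : (2 <= r n)%N /\ (r n + 2 <= N n)%N by near: n.
have N0 : 0 < (N n)%:R :> R by rewrite ltr0n; apply: leq_trans rN; rewrite addnS.
have H1 : 1 - (r n)%:R / (N n)%:R - q * (1 - (l n)%:R / (N n)%:R) < 0 by near: n.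
have H2 : q ^+ M * ((r n)%:R / (N n)%:R + (N n)%:R^-1) -
     (1 - (r n)%:R / (N n)%:R) * ((r n)%:R / (N n)%:R - (l n)%:R / (N n)%:R) < 0 by near: n.
have H3 : (l n)%:R / (N n)%:R - (r n)%:R / (N n)%:R < 0 :> R by near: n.
by move=> t rt tN; apply: small_excess_ratio rt tN q0 (ltW q1) N0 H1 H2 H3.
Unshelve. all: by end_near.
Qed.

Lemma word_width_nseq M K s : word_width K s (nseq M false) = 'C(K - M, s).
Proof.
elim: M K => [|M IH] K /=; first by rewrite subn0.
by rewrite IH; congr 'C(_, _); lia.
Qed.

Lemma word_measure_nseq M a : word_measure a (nseq M false) = a ^+ M.
Proof. by elim: M => [|M IH] //=; rewrite IH exprS. Qed.

Lemma big_regime a g N r l M : 0 < a -> a < g -> g < 1 ->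
  (forall J, exists2 m, 0 < m & forall x u, lex_region a g x u -> a ^+ J < x ->
    (1 + (1 - a) / a * x) * (1 - u) <= 1 - m) ->
  asymp N r (1 - a) -> asymp N l (1 - g) -> exists D, \forall n \near \oo, forall w : D.-tuple bool,
  let low := word_low (N n) (r n) w in let width := word_width (N n) (r n) w in
  (low + width < 'C(N n - M, r n))%N \/
  (('C(N n, (r n).+1) + low + width)%:R * ('C(N n, l n)%:R - (word_low (N n) (l n) w)%:R) <
    'C(N n, (r n).+1)%:R * 'C(N n, l n)%:R :> R).
Proof.
move=> a0 ag g1 gap asymp_r asymp_l; have a1 := lt_trans ag g1; have g0 := lt_trans a0 ag.
have rho_a : 0 < 1 - a < 1 by rewrite subr_gt0 a1 ltrBlDr ltrDl.
have rho_g : 0 < 1 - g < 1 by rewrite subr_gt0 g1 ltrBlDr ltrDl.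
have [m m0 mP] := gap M.+1.
set c := (1 - a) / a in mP.
have c0 : 0 < c by rewrite divr_gt0 //; lra.
have aM : 0 < a ^+ M by rewrite exprn_gt0.
have e0 : 0 < Num.min (a ^+ M * (1 - a)) (m / c).
  by rewrite lt_min mulr_gt0 ?divr_gt0 //; lra.
have [D] : exists D, Num.max a (1 - a) ^+ D < Num.min (a ^+ M * (1 - a)) (m / c).
  by apply: exists_expr_lt => //; rewrite le_max gt_max ltW //=; lra.
rewrite lt_min ltr_pdivlMr // => /andP[D1 D2].
exists D; apply: filter_forall => w /=.
have a01 : 0 < a < 1 by rewrite a0 a1.
have /andP[ww0 wwD] := word_measure_bound w a01; rewrite size_tuple in wwD.
have [cl1 cw1] := cvg_word w rho_a asymp_r.
have [cl2 _] := cvg_word w rho_g asymp_l.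
rewrite !subKr in cl1 cw1 cl2.
have room_r := asymp_room M.+2 rho_a asymp_r.
have room_l := asymp_room 2 rho_g asymp_l.
have [low|high] := lerP (word_point a w) (a ^+ M.+1).
  have [_ cM] := cvg_word (nseq M false) rho_a asymp_r.
  rewrite subKr word_measure_nseq in cM.
  have c4 : (fun n => (word_low (N n) (r n) w)%:R / 'C(N n, r n)%:R +
      (word_width (N n) (r n) w)%:R / 'C(N n, r n)%:R -
      (word_width (N n) (r n) (nseq M false))%:R / 'C(N n, r n)%:R : R) @ \oo
      --> word_point a w + word_measure a w - a ^+ M by apply: cvgB => //; apply: cvgD.
  have lt0 : word_point a w + word_measure a w - a ^+ M < 0.
    rewrite exprS in low.
    by have := le_lt_trans wwD D1; clear -low; lra.
  have h := cvgr_lt _ c4 0 lt0.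
  near=> n; left; have [r2 rN] : (M.+2 <= r n)%N /\ (r n + M.+2 <= N n)%N by near: n.
  have H : (word_low (N n) (r n) w)%:R / 'C(N n, r n)%:R +
      (word_width (N n) (r n) w)%:R / 'C(N n, r n)%:R -
      (word_width (N n) (r n) (nseq M false))%:R / 'C(N n, r n)%:R < 0 :> R by near: n; apply: h.
  have rlt : (r n < N n)%N by apply: leq_trans rN; rewrite addnS ltnS leq_addr.
have C0 : 0 < 'C(N n, r n)%:R :> R by rewrite ltr0n bin_gt0 ltnW.
  move: H; rewrite -mulrDl -mulrBl pmulr_llt0 ?invr_gt0 // subr_lt0 -natrD ltr_nat.
  by rewrite word_width_nseq.
have reg := mP _ _ (lex_region_word a g w) high.
have c5 : (fun n => (1 + 'C(N n, r n)%:R / 'C(N n, (r n).+1)%:R *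
      ((word_low (N n) (r n) w)%:R / 'C(N n, r n)%:R +
       (word_width (N n) (r n) w)%:R / 'C(N n, r n)%:R)) *
     (1 - (word_low (N n) (l n) w)%:R / 'C(N n, l n)%:R) : R) @ \oo -->
   (1 + c * (word_point a w + word_measure a w)) * (1 - word_point g w).
  apply: cvgM; last by apply: cvgB => //; apply: cvg_cst.
  apply: cvgD; first exact: cvg_cst.
  by apply: cvgM; [exact: cvg_bin_succ | exact: cvgD].
have lt1 : (1 + c * (word_point a w + word_measure a w)) * (1 - word_point g w) < 1.
  have [y0 y1 yv v1] := lex_region_itv a0 (ltW ag) g1 (lex_region_word a g w).
  have : c * word_measure a w * (1 - word_point g w) <= c * word_measure a w * 1.
    have cw0 := ltW (mulr_gt0 c0 ww0).
    by rewrite ler_wpM2l // lerBlDr lerDl (le_trans y0 yv).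
  have : word_measure a w * c < m by apply: le_lt_trans D2; rewrite ler_pM2r.
  clear -reg; lra.
have h := cvgr_lt _ c5 1 lt1.
near=> n; right; have [r2 rN] : (M.+2 <= r n)%N /\ (r n + M.+2 <= N n)%N by near: n.
have [l2 lN] : (2 <= l n)%N /\ (l n + 2 <= N n)%N by near: n.
have H : (1 + 'C(N n, r n)%:R / 'C(N n, (r n).+1)%:R *
      ((word_low (N n) (r n) w)%:R / 'C(N n, r n)%:R +
       (word_width (N n) (r n) w)%:R / 'C(N n, r n)%:R)) *
     (1 - (word_low (N n) (l n) w)%:R / 'C(N n, l n)%:R) < 1 :> R by near: n; apply: h.
have rlt : (r n < N n)%N by apply: leq_trans rN; rewrite addnS ltnS leq_addr.
have C0 : 0 < 'C(N n, r n)%:R :> R by rewrite ltr0n bin_gt0 ltnW.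
have P0 : 0 < 'C(N n, (r n).+1)%:R :> R by rewrite ltr0n bin_gt0.
have Q0 : 0 < 'C(N n, l n)%:R :> R by rewrite ltr0n bin_gt0 (leq_trans _ lN) // leq_addr.
rewrite -(ltr_pM2r (mulr_gt0 P0 Q0)) mul1r in H.
apply: le_lt_trans H; rewrite le_eqVlt; apply/orP; left; apply/eqP.
rewrite !natrD; field.
by rewrite !gt_eqF.
Unshelve. all: by end_near.
Qed.

Lemma one_sided_at (n k l M D : nat) (A B : {set {set 'I_n}}) :
  let N := n.-1 in let r := (n - k).-1 in let l' := l.-1 in
  (0 < k)%N -> (0 < l)%N -> (k + l < n)%N -> (D <= l')%N -> (D <= r)%N -> (D + r <= N)%N ->
  (forall t, (r <= t)%N -> (t + M < N)%N ->
     ('C(t.+1, r) * 'C(N, l') <= 'C(N, r.+1) * 'C(t, l'))%N) ->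
  (forall w : D.-tuple bool,
    let low := word_low N r w in let width := word_width N r w in
    (low + width < 'C(N - M, r))%N \/
    (('C(N, r.+1) + low + width)%:R * ('C(N, l')%:R - (word_low N l' w)%:R) <
      'C(N, r.+1)%:R * 'C(N, l')%:R :> R)) ->
  A \subset layer n k -> B \subset layer n l -> cross_intersecting A B ->
  ('C(n.-1, k.-1) < #|A|)%N ->
  (#|A| * #|B| < 'C(n.-1, k.-1) * 'C(n.-1, l.-1))%N.
Proof.
move=> N r l' k0 l0 kln Dl Dr DN small big Ak Bl AB ltA.
have PE : 'C(n.-1, k.-1) = 'C(N, r.+1).
  rewrite -bin_sub; last by lia.
  by congr 'C(_, _); rewrite /N /r; lia.
have key s := cross_key (s := s) Ak Bl AB k0 l0 kln.
rewrite -/N -/r -/l' in key *; rewrite -/N PE in key ltA *.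
set P := 'C(N, r.+1) in small big key ltA *; set Q := 'C(N, l') in small big key *.
have cA : (#|A| <= P + 'C(N, r))%N.
  apply: leq_trans (subset_leq_card Ak) _; rewrite card_layer -bin_sub; last by lia.
  rewrite -binS; have -> : (n - k)%N = r.+1 by rewrite /r; lia.
  by have -> : n = N.+1 by rewrite /N; lia.
set f := (#|A| - P)%N.
have Af : #|A| = (P + f)%N by rewrite /f; lia.
have fN : (f <= 'C(N, r))%N by rewrite /f; lia.
have f0 : (0 < f)%N by rewrite /f; lia.
have Q0 : (0 < Q)%N by rewrite bin_gt0 /l' /N; lia.
have [small_f|big_f] := ltnP f 'C(N - M, r).
  have rM : (r <= N - M)%N by rewrite -bin_gt0; apply: leq_ltn_trans small_f.
  have [|t [rt tM /andP[t1 t2]]] := @bracket (fun t => 'C(t, r)) r (N - M) f rM.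
    by rewrite binn f0.
  have tMN : (t + M < N)%N by lia.
  have := key [:: t]; have -> : valid_casc N r [:: t].
    by apply/andP; split; [apply/andP; split=> //; lia | case: (r)].
  have -> : casc r [:: t] = 'C(t, r) by rewrite /=; case: (r) => [|?]; rewrite addn0.
  have -> : casc l' [:: t] = 'C(t, l') by rewrite /=; case: (l') => [|?]; rewrite addn0.
  move=> /(_ isT); rewrite Af leq_add2l => /(_ t1) leB.
  have lt : (f * Q < P * 'C(t, l'))%N.
    by apply: leq_trans (small t rt tMN); rewrite ltn_pmul2r.
  have : (f * #|B| <= f * Q)%N by rewrite leq_mul2l (leq_trans _ leB) ?leq_addl ?orbT.
  have : (P * 'C(t, l') + P * #|B| <= P * Q)%N by rewrite -mulnDr leq_mul2l leB orbT.
  rewrite mulnDl; lia.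
have [w /andP[w1 w2]] := @word_exists D N r f Dr DN fN.
case: (big w) => [lt|]; first by lia.
have vw : valid_casc N r (word_list N w).
  by apply: valid_word_list; rewrite size_tuple.
have := key _ vw; rewrite !casc_word_list ?size_tuple // Af leq_add2l => /(_ w1) leB.
move=> ltR; rewrite -(ltr_nat R) !natrM; apply: le_lt_trans ltR.
apply: ler_pM; rewrite ?ler0n //; first by rewrite ler_nat; lia.
by rewrite -natrB ?ler_nat; lia.
Qed.

Theorem one_sided_bound a g (k l : nat -> nat) : 0 < a -> a < g -> g < 1 ->
  (forall J, exists2 m, 0 < m & forall x u, lex_region a g x u -> a ^+ J < x ->
    (1 + (1 - a) / a * x) * (1 - u) <= 1 - m) ->
  (fun n => (k n)%:R / n%:R : R) @ \oo --> a ->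
  (fun n => (l n)%:R / n%:R : R) @ \oo --> 1 - g ->
  \forall n \near \oo, forall A B : {set {set 'I_n}},
    A \subset layer n (k n) -> B \subset layer n (l n) -> cross_intersecting A B ->
    ('C(n.-1, (k n).-1) < #|A|)%N ->
    (#|A| * #|B| < 'C(n.-1, (k n).-1) * 'C(n.-1, (l n).-1))%N.
Proof.
move=> a0 ag g1 gap ck cl; have a1 := lt_trans ag g1; have g0 := lt_trans a0 ag.
have a01 : 0 < a < 1 by rewrite a0.
have rho_a : 0 < 1 - a < 1 by rewrite subr_gt0 a1 ltrBlDr ltrDl.
have rho_g : 0 < 1 - g < 1 by rewrite subr_gt0 g1 ltrBlDr ltrDl.
have asymp_k := asymp_id ck.
have asymp_r := asymp_pred true rho_a (asymp_compl a01 asymp_k).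
have asymp_l := asymp_pred true rho_g (asymp_id cl).
have [M small] := small_regime a0 ag g1 asymp_r asymp_l.
have [D big] := big_regime M a0 ag g1 gap asymp_r asymp_l.
have room_k := asymp_room 1 a01 asymp_k.
have room_r := asymp_room D rho_a asymp_r.
have room_l := asymp_room D.+1 rho_g asymp_l.
have ckl : (fun n => (k n)%:R / n%:R + (l n)%:R / n%:R : R) @ \oo --> a + (1 - g).
  exact: cvgD.
have h : \forall n \near \oo, (k n)%:R / n%:R + (l n)%:R / n%:R < 1 :> R.
  by apply: cvgr_lt ckl _ _; rewrite addrCA gtrDl subr_lt0.
near=> n => A B Ak Bl AB.
have [k1 _] : (1 <= k n)%N /\ (k n + 1 <= n)%N by near: n.
have [Dr rN] : (D <= (n - k n).-1)%N /\ ((n - k n).-1 + D <= n.-1)%N by near: n.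
have [Dl _] : (D.+1 <= (l n).-1)%N /\ ((l n).-1 + D.+1 <= n.-1)%N by near: n.
have n0 : (0 < n)%N by near: n; apply: nbhs_infty_gt.
have kln : (k n + l n < n)%N.
  have : (k n)%:R / n%:R + (l n)%:R / n%:R < 1 :> R by near: n.
  by rewrite -mulrDl ltr_pdivrMr ?ltr0n // mul1r -natrD ltr_nat.
have l0 : (0 < l n)%N by apply: leq_trans (leq_pred _); apply: leq_trans Dl.
rewrite addnC in rN.
apply: (one_sided_at (M := M) k1 l0 kln (ltnW Dl) Dr rN) => //.
  by near: n.
by near: n.
Unshelve. all: by end_near.
Qed.
End OneSidedBound.

(** * Large ground sets *)

Section EventualBound.
Local Open Scope classical_set_scope.

Lemma cvg_truncn (R : realType) (x : R) : 0 <= x ->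
  (fun n => (Num.truncn (x * n%:R))%:R / n%:R : R) @ \oo --> x.
Proof.
move=> x0; have cinv := @cvg_invn R.
apply: (@squeeze_cvgr _ _ _ _ (fun n => x - n%:R^-1) (fun=> x)); last exact: cvg_cst.
  near=> n; have n0 : 0 < n%:R :> R by rewrite ltr0n; near: n; apply: nbhs_infty_gt.
  have /truncn_itv/andP[le lt] : 0 <= x * n%:R by rewrite mulr_ge0 // ltW.
  rewrite ler_pdivrMr // le andbT ler_pdivlMr // mulrBl mulVf ?gt_eqF //.
  by rewrite lerBlDr natr1 ltW.
by rewrite -[X in _ --> X]subr0; apply: cvgB => //; apply: cvg_cst.
Unshelve. all: by end_near.
Qed.

Lemma eventually_strict (R : realType) (alpha beta : R)
    (alpha_gt0 : 0 < alpha) (beta_gt_half : 2^-1 < beta)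
    (alpha_beta_lt1 : alpha + beta < 1)
    (cond : forall j : nat,
       (1 + (1 - alpha) * alpha ^+ j) * (1 - (1 - beta) ^+ j.+1) < 1) :
  \forall n \near \oo,
    let k := Num.truncn (alpha * n%:R) in let l := Num.truncn (beta * n%:R) in
    [/\ (0 < k)%N, (0 < l)%N & (k + l < n)%N] /\
    (forall A B : {set {set 'I_n}},
      A \subset layer n k -> B \subset layer n l -> cross_intersecting A B ->
      ('C(n.-1, k.-1) < #|A|)%N || ('C(n.-1, l.-1) < #|B|)%N ->
      (#|A| * #|B| < 'C(n.-1, k.-1) * 'C(n.-1, l.-1))%N).
Proof.
have g_a : alpha < 1 - beta by lra.
have g_half : 1 - beta < 2^-1 by lra.
have g_b : beta < 1 - alpha by lra.
have g_1 : 1 - beta < 1 by lra.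
have a_1 : 1 - alpha < 1 by lra.
have cond' j : (1 - alpha) * alpha ^+ j * (1 - (1 - beta) ^+ j.+1) < (1 - beta) ^+ j.+1.
  by have := cond j; move: (alpha ^+ j) ((1 - beta) ^+ j.+1) => u v; clear; lra.
have ca := cvg_truncn (ltW alpha_gt0).
have cb : (fun n => (Num.truncn (beta * n%:R))%:R / n%:R : R) @ \oo --> beta.
  by apply: cvg_truncn; lra.
have cb' : (fun n => (Num.truncn (beta * n%:R))%:R / n%:R : R) @ \oo --> 1 - (1 - beta).
  by rewrite subKr.
have ca' : (fun n => (Num.truncn (alpha * n%:R))%:R / n%:R : R) @ \oo --> 1 - (1 - alpha).
  by rewrite subKr.
have beta_gt0 : 0 < beta by lra.
have a01 : 0 < alpha < 1 by apply/andP; split; lra.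
have b01 : 0 < beta < 1 by apply/andP; split; lra.
have := one_sided_bound alpha_gt0 g_a g_1 (lex_region_gap alpha_gt0 g_a g_half cond') ca cb'.
have := one_sided_bound beta_gt0 g_b a_1 (lex_region_gap_half beta_gt_half g_b a_1) cb ca'.
have := asymp_room 1 a01 (asymp_id ca); have := asymp_room 1 b01 (asymp_id cb).
have : \forall n \near \oo, (Num.truncn (alpha * n%:R))%:R / n%:R +
    (Num.truncn (beta * n%:R))%:R / n%:R < 1 :> R.
  by apply: cvgr_lt (cvgD ca cb) _ alpha_beta_lt1.
move=> h1 h2 h3 h4 h5; near=> n.
have [k0 kn] : (1 <= Num.truncn (alpha * n%:R))%N /\
    (Num.truncn (alpha * n%:R) + 1 <= n)%N by near: n.
have n0 : (0 < n)%N by apply: leq_trans kn; rewrite addn1.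
have [l0 _] : (1 <= Num.truncn (beta * n%:R))%N /\
    (Num.truncn (beta * n%:R) + 1 <= n)%N by near: n.
split.
  split=> //.
  have : (Num.truncn (alpha * n%:R))%:R / n%:R +
      (Num.truncn (beta * n%:R))%:R / n%:R < 1 :> R by near: n.
  by rewrite -mulrDl ltr_pdivrMr ?ltr0n // mul1r -natrD ltr_nat.
move=> A B Ak Bl AB /orP[ltA|ltB].
  by move: A B Ak Bl AB ltA; near: n.
rewrite mulnC [X in (_ < X)%N]mulnC.
by move: AB => /cross_intersecting_sym; move: ltB => /[swap]; move: B A Bl Ak; near: n.
Unshelve. all: by end_near.
Qed.

End EventualBound.

(* World: MathComp. [Num.truncn x] is the floor of x as a nat (for x >= 0). *)
Theorem theorem2 (R : realType) (alpha beta : R)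
    (alpha_gt0 : 0 < alpha) (beta_gt_half : 2^-1 < beta)
    (alpha_beta_lt1 : alpha + beta < 1)
    (cond : forall j : nat,
       (1 + (1 - alpha) * alpha ^+ j) * (1 - (1 - beta) ^+ j.+1) < 1) :
  exists n0 : nat, forall n : nat, (n0 < n)%N ->
    let k := Num.truncn (alpha * n%:R) in
    let l := Num.truncn (beta * n%:R) in
    max_cross n k l = ('C(n.-1, k.-1) * 'C(n.-1, l.-1))%N /\
    (forall A B : {set {set 'I_n}},
       A \subset layer n k -> B \subset layer n l ->
       cross_intersecting A B ->
       (#|A| * #|B|)%N = ('C(n.-1, k.-1) * 'C(n.-1, l.-1))%N ->
       exists i : 'I_n,
         A = [set X in layer n k | i \in X] /\
         B = [set Y in layer n l | i \in Y]).
Proof.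
have [n0 _ main] := eventually_strict alpha_gt0 beta_gt_half alpha_beta_lt1 cond.
exists n0 => n /ltnW/main /= {main}.
set k := Num.truncn (alpha * n%:R); set l := Num.truncn (beta * n%:R).
move=> [[k0 l0 kln] strict].
set P := 'C(n.-1, k.-1) in strict *; set Q := 'C(n.-1, l.-1) in strict *.
have P0 : (0 < P)%N by rewrite bin_gt0; lia.
have Q0 : (0 < Q)%N by rewrite bin_gt0; lia.
have bound (A B : {set {set 'I_n}}) :
    A \subset layer n k -> B \subset layer n l -> cross_intersecting A B ->
    (#|A| * #|B| <= P * Q)%N /\ ((#|A| * #|B|)%N = (P * Q)%N -> #|A| = P /\ #|B| = Q).
  move=> Ak Bl AB.
  have [lt|] := boolP ((P < #|A|)%N || (Q < #|B|)%N).
    have lt' := strict _ _ Ak Bl AB lt.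
    by split=> [|e]; [apply: ltnW | move: lt'; rewrite e ltnn].
  rewrite negb_or -!leqNgt => /andP[leA leB]; split; first exact: leq_mul.
  move=> e; have eA : #|A| = P.
    apply/eqP; rewrite eqn_leq leA /= -(leq_pmul2r Q0) -e.
    by rewrite leq_mul2l leB orbT.
  split=> //; apply/eqP; rewrite -(eqn_pmul2l P0) -e eA //.
split; last first.
  move=> A B Ak Bl AB /(bound A B Ak Bl AB).2 [cA cB].
  exact: cross_extremal Ak Bl AB k0 l0 kln cA cB.
apply/eqP; rewrite eqn_leq; apply/andP; split.
  by apply/bigmax_leqP => -[A B] /= /and3P[Ak Bl AB]; have [] := bound A B Ak Bl AB.
by apply: star_le_max_cross; lia.
Qed.
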